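(* Let $n\ge1$, $0\le k\le n$, and let $(\sigma,\eta,\rho)$ be Blaschke interpolation data with $n$ interpolation nodes of which $k$ lie in $\mathbb T$. Suppose that $h$ is a solution of the royal $\Gamma$-interpolation problem with these data and that $h(\mathbb D)\not\subset\mathcal R$. For all $\omega\in\mathbb T\setminus\{-\overline{\eta_1},-\overline{\eta_2},\dots,-\overline{\eta_k}\}$, the function $\Phi_\omega\circ h$ is a solution of the Blaschke interpolation problem with the same data. Conversely, for every solution $\varphi$ of the Blaschke interpolation problem with data $(\sigma,\eta,\rho)$ there exists $\omega\in\mathbb T$ such that $\varphi=\Phi_\omega\circ h$.
   Context: $\mathbb D$ is the open unit disc, $\mathbb T$ the unit circle. Phasar derivative: for differentiable $f:\mathbb T\to\mathbb C\setminus\{0\}$, $Af(e^{i\theta})=\frac{d}{d\theta}\arg f(e^{i\theta})$; for a rational inner function $\varphi$, $A\varphi(z)=z\varphi'(z)/\varphi(z)$ on $\mathbb T$. A rational inner function is the same as a finite Blaschke product. Blaschke interpolation data: a triple $(\sigma,\eta,\rho)$ where $\sigma=(\sigma_1,\dots,\sigma_n)$ are distinct points with $\sigma_j\in\mathbb T$ for $j\le k$ and $\sigma_j\in\mathbb D$ for $k<j\le n$; $\eta=(\eta_1,\dots,\eta_n)$ with $\eta_j\in\mathbb T$ for $j\le k$ and $\eta_j\in\mathbb D$ for $k<j\le n$; and $\rho=(\rho_1,\dots,\rho_k)$ with all $\rho_j>0$. Blaschke interpolation problem with data $(\sigma,\eta,\rho)$: find a rational inner function $\varphi$ of degree (exactly)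 $n$ such that $\varphi(\sigma_j)=\eta_j$ for $j=1,\dots,n$ and $A\varphi(\sigma_j)=\rho_j$ for $j=1,\dots,k$. $\Gamma=\{(z+w,zw):|z|\le1,|w|\le1\}\subset\mathbb C^2$, with distinguished boundary $b\Gamma=\{(z+w,zw):|z|=|w|=1\}$. A $\Gamma$-inner function is a holomorphic map $h:\mathbb D\to\Gamma$ whose boundary values at almost all points of $\mathbb T$ lie in $b\Gamma$; it is rational if its two components are. The degree of a rational $\Gamma$-inner function $h=(s,p)$ is the topological degree of $h|_{\mathbb T}:\mathbb T\to b\Gamma$ (the fundamental group of $b\Gamma$, a M\''obius band, is $\mathbb Z$); it is known to equal the degree of the finite Blaschke product $p$. The royal variety is $\mathcal R=\{(2z,z^2):z\in\mathbb C\}$. Royal $\Gamma$-interpolation problem with data $(\sigma,\eta,\rho)$: find a rational $\Gamma$-inner function $h=(s,p)$ of degree $n$ such that $h(\sigma_j)=(-2\eta_j,\eta_j^2)$ for $j=1,\dots,n$ and $Ap(\sigma_j)=2\rho_j$ for $j=1,\dots,k$. For $\omega\in\mathbb T$, $\Phi_\omega(s,p)=\frac{2\omega p-s}{2-\omega s}$, so $\Phi_\omega\circ h$ is the rational function $\frac{2\omega p-s}{2-\omega s}$ when $h=(s,p)$. *)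

(* Defs.v *)
From HB Require Import structures.
From mathcomp Require Import all_boot all_order all_algebra.
From mathcomp Require Import all_classical all_reals all_analysis.
From mathcomp Require Import complex.

Set Implicit Arguments.
Unset Strict Implicit.
Unset Printing Implicit Defensive.

Import Order.TTheory GRing.Theory Num.Theory.
Import numFieldNormedType.Exports.

Local Open Scope classical_set_scope.
Local Open Scope ring_scope.

(* The topology of R[i] is the one given by the modulus; R[i] is thereby a
   normed module over itself, so that [derivable f z 1] is complex
   differentiability of [f] at [z]. *)
HB.instance Definition _ (R : rcfType) := NormedModule.copy R[i] R[i]^o.

Section Plane.
Variable R : realType.
Local Notation C := R[i].

Definition disc : set C := [set z | `|z| < 1].
Definition cdisc : set C := [set z | `|z| <= 1].
Definition circle : set C := [set z | `|z| = 1].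

(* e^{it} *)
Definition expi (t : R) : C := (cos t +i* sin t)%C.

Definition holomorphic_disc (f : C -> C) : Prop :=
  forall z, disc z -> derivable f z 1.

Definition radial_limit (f : C -> C) (t : R) (l : C) : Prop :=
  (fun r : R => f (r%:C%C * expi t)) @ (1 : R)^'- --> l.

(* A f(z) = a, for z = e^{it}: here u is a branch of arg f(e^{ix}) for x near
   t, and a is its derivative at t. The branch is unique up to an additive
   constant near t, so a is unique. *)
Definition is_phasar_derivative (f : C -> C) (z : C) (a : R) : Prop :=
  exists (t : R) (u : R -> R),
    [/\ z = expi t,
        (\forall x \near t, f (expi x) != 0 /\
                            f (expi x) = `|f (expi x)| * expi (u x)) &
        is_derive t (1 : R) u a].

Definition inner (f : C -> C) : Prop :=
  [/\ holomorphic_disc f,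
      (forall z, disc z -> cdisc (f z)) &
      {ae (@lebesgue_measure R), forall t : R,
         exists2 l, circle l & radial_limit f t l}].

Definition Gamma : set (C * C) :=
  [set x | exists z w, [/\ cdisc z, cdisc w & x = (z + w, z * w)]].

Definition bGamma : set (C * C) :=
  [set x | exists z w, [/\ circle z, circle w & x = (z + w, z * w)]].

Definition Gamma_inner (h : C -> C * C) : Prop :=
  [/\ holomorphic_disc (fun z => (h z).1),
      holomorphic_disc (fun z => (h z).2),
      (forall z, disc z -> Gamma (h z)) &
      {ae (@lebesgue_measure R), forall t : R,
         exists2 l, bGamma l &
           radial_limit (fun z => (h z).1) t l.1 /\
           radial_limit (fun z => (h z).2) t l.2}].

Definition royal : set (C * C) := [set x | exists z, x = (2 * z, z ^+ 2)].

(* h restricted to the circle is a loop in bGamma of topological degree n: it is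
   freely homotopic in bGamma to the n-th power z |-> (1 + z^n, 1 * z^n) of the
   generator z |-> (1 + z, 1 * z) of the fundamental group of bGamma. That group
   is Z, hence abelian, so base points are irrelevant. The choice of generator
   is the one for which the degree of (s, p) is that of p. *)
Definition has_topological_degree (h : C -> C * C) (n : nat) : Prop :=
  exists H : R * C -> C * C,
    [/\ {within `[0, 1] `*` circle, continuous H},
        (forall (t : R) (z : C), 0 <= t <= 1 -> circle z -> bGamma (H (t, z))),
        (forall z, circle z -> H (0, z) = h z) &
        (forall z, circle z -> H (1, z) = (1 + z ^+ n, z ^+ n))].

End Plane.

Section RationalFunctions.
Variable R : realType.
Local Notation C := R[i].

Definition ratfun : Type := {fraction {poly C}}.

(* Numerator and denominator in lowest terms (unique up to a common scalar). *)
Definition rnum (f : ratfun) : {poly C} :=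
  let r := fraction.frac (repr f) in r.1 %/ gcdp r.1 r.2.
Definition rden (f : ratfun) : {poly C} :=
  let r := fraction.frac (repr f) in r.2 %/ gcdp r.1 r.2.

(* Equal to 0 at the poles of f. *)
Definition reval (f : ratfun) (z : C) : C := (rnum f).[z] / (rden f).[z].

Definition rdegree (f : ratfun) : nat := (maxn (size (rnum f)) (size (rden f))).-1.

Definition rconst (c : C) : ratfun := FracField.tofrac c%:P.

Definition rational_inner (phi : ratfun) : Prop := inner (reval phi).

Definition reval2 (h : ratfun * ratfun) (z : C) : C * C :=
  (reval h.1 z, reval h.2 z).

Definition rational_Gamma_inner (h : ratfun * ratfun) : Prop :=
  Gamma_inner (reval2 h).

End RationalFunctions.

Definition Phi (F : fieldType) (omega : F) (x : F * F) : F :=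
  (2 * omega * x.2 - x.1) / (2 - omega * x.1).

(* The rational function Phi_omega \o h. *)
Definition Phi_comp (R : realType) (omega : R[i]) (h : ratfun R * ratfun R) :
  ratfun R := Phi (rconst omega) h.

Section Problems.
Variables (R : realType) (n k : nat) (hk : (k <= n)%N).
Local Notation C := R[i].
Variables (sigma eta : 'I_n -> C) (rho : 'I_k -> R).

Definition Blaschke_data : Prop :=
  [/\ injective sigma,
      (forall j : 'I_n, (j < k)%N -> circle (sigma j) /\ circle (eta j)),
      (forall j : 'I_n, (k <= j)%N -> disc (sigma j) /\ disc (eta j)) &
      (forall j : 'I_k, 0 < rho j)].

Definition Blaschke_solution (phi : ratfun R) : Prop :=
  [/\ rational_inner phi, rdegree phi = n,
      (forall j : 'I_n, reval phi (sigma j) = eta j) &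
      (forall j : 'I_k,
         is_phasar_derivative (reval phi) (sigma (widen_ord hk j)) (rho j))].

Definition royal_Gamma_solution (h : ratfun R * ratfun R) : Prop :=
  [/\ rational_Gamma_inner h, has_topological_degree (reval2 h) n,
      (forall j : 'I_n, reval2 h (sigma j) = (- 2 * eta j, eta j ^+ 2)) &
      (forall j : 'I_k,
         is_phasar_derivative (reval h.2) (sigma (widen_ord hk j))
           (2 * rho j))].

End Problems.

(* Main.v *)
Require Import Defs.
From mathcomp Require Import all_boot all_order all_algebra.
From mathcomp Require Import all_classical all_reals all_analysis.
From mathcomp Require Import complex.
From mathcomp Require Import ring lra zify.

(** Write h = (s, p).  Being a bounded rational function that is unimodular
    almost everywhere on the circle, p is a quotient N / D of polynomials in
    which D has no zero in the closed disc and N = c D~ for a unimodular c,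
    where D~(z) = z^m conj(D(1 / conj z)) is the reflection of D and m is the
    degree of p ([inner_refl]).  On the boundary of Gamma one has
    s = conj(s) p; this forces s = E / D over the same denominator, with
    E = c E~ ([Gamma_inner_refl]).  A homotopy of p to z^n through maps
    of the circle to itself forces m = n ([winding_refl_quotient]).

    Everything then rests on the royal polynomial 4 D N - E^2, whose zeros are
    the points that h sends to the royal variety.  It is its own reflection up
    to a constant, has degree at most 2n, and on the circle it is a unimodular
    multiple of 4 |D|^2 - |E|^2 >= 0.  So a node in the disc contributes a zero
    together with its mirror image, and a node on the circle a double zero, the
    minimum of a nonnegative function.  That makes 2n zeros: the nodes are the
    only zeros in the closed disc ([royal_solution_form]).

    Direct part.  Phi_omega o h is the quotient of P = 2 omega N - E by
    Q = 2 D - omega E, and P = omega c Q~.  If Q vanishes at z in the closed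
    disc then s(z) = 2 conj(omega), which is extremal in Gamma and forces
    p(z) = conj(omega)^2; hence z is a zero of the royal polynomial, so a node
    sigma_j, and omega = - conj(eta_j) is one of the excluded values.  Thus P / Q
    is a Blaschke product of degree n, because Phi_omega maps Gamma into the
    closed disc ([Phi_contractive]); its value at a node is clear.  The
    double zero of the royal polynomial at a boundary node says that
    2 s' / s = p' / p there, and this makes the phasar derivative of P / Q half
    that of p ([phi_phasar]).

    Converse.  Let phi = U / M be a solution, and tau a point of the circle that
    is not a node.  There is a unimodular omega with
    Phi_omega(h(tau)) = phi(tau).  The cross difference U Q - P M is its own
    reflection up to a constant, has degree at most 2n, vanishes at every node
    and doubly at the boundary nodes.  As it also vanishes at tau, it is zero
    ([reflective_root_mem]), whence phi = Phi_omega o h. *)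

Set Implicit Arguments.
Unset Strict Implicit.
Unset Printing Implicit Defensive.

Import Order.TTheory GRing.Theory Num.Theory.
Import numFieldNormedType.Exports.

Local Open Scope classical_set_scope.
Local Open Scope ring_scope.

(** * Reflection of polynomials in the unit circle *)

Section Reflection.
Variable C : numClosedFieldType.
Implicit Types (F G : {poly C}) (z s : C) (d : nat).

Lemma poly_eq0_inj F (g : nat -> C) :
  injective g -> (forall k, F.[g k] = 0) -> F = 0.
Proof.
move=> ginj Fg; apply/eqP/negPn/negP => nz.
have /max_poly_roots : all (root F) (map g (iota 0 (size F))).
  by apply/allP => _ /mapP[k _ ->]; rewrite rootE Fg.
move=> /(_ nz); rewrite map_inj_uniq // iota_uniq => /(_ isT).
by rewrite size_map size_iota ltnn.
Qed.

(** The circle is infinite: the numbers (1 + ik) / (1 - ik) are distinct. Identities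
    between reflections are proved by evaluation on the circle, where reflection
    is conjugation up to a power of z. *)
Lemma poly_eq_circle F G :
  (forall z, `|z| = 1 -> F.[z] = G.[z]) -> F = G.
Proof.
move=> FG.
pose f (k : nat) : C := (1 + 'i * k%:R) / (1 - 'i * k%:R).
have dnz k : 1 - 'i * k%:R != 0 :> C.
  apply/eqP => /(congr1 (fun x => 'Re x)).
  have -> : (1 - 'i * k%:R : C) = 1 + 'i * (- k%:R) by ring.
  rewrite Re_rect ?rpred1 ?rpredN ?realn // raddf0 => /eqP.
  by rewrite oner_eq0.
have f1 k : `|f k| = 1.
  rewrite normf_div; have -> : `|1 - 'i * k%:R| = `|1 + 'i * k%:R| :> C.
    rewrite -[RHS]norm_conjC; congr `|_|.
    by rewrite rmorphD rmorph1 rmorphM /= conjCi conjC_nat mulNr.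
  rewrite divff // normr_eq0 -[1 + _]conjCK conjC_eq0.
  by rewrite rmorphD rmorph1 rmorphM /= conjCi conjC_nat mulNr.
have finj : injective f.
  move=> a b /eqP; rewrite /f eqr_div // => /eqP e.
  have : 'i * (a%:R - b%:R) *+ 2 = 0 :> C.
    have := congr1 (fun x => x - (1 + 'i * b%:R) * (1 - 'i * a%:R)) e.
    by rewrite subrr => <-; ring.
  move/eqP; rewrite mulrn_eq0 /= mulf_eq0 (negbTE (neq0Ci _)) /= subr_eq0 eqr_nat.
  by move/eqP.
apply/eqP; rewrite -subr_eq0; apply/eqP; apply: (poly_eq0_inj finj) => k.
by rewrite !hornerE FG ?subrr.
Qed.

(** The reflection z^d conj(F(1 / conj z)) of F, of formal degree d. The formal
    degree is a parameter because a zero of F at the origin lowers the degree of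
    the reflection, and zeros at infinity must be counted. *)
Definition refl d F : {poly C} := \poly_(i < d.+1) (F`_(d - i))^*.

Lemma size_refl d F : (size (refl d F) <= d.+1)%N.
Proof. exact: size_poly. Qed.

Lemma coef_refl d F i : (i <= d)%N -> (refl d F)`_i = (F`_(d - i))^*.
Proof. by move=> id; rewrite coef_poly ltnS id. Qed.

Lemma horner_refl d F z : (size F <= d.+1)%N -> z != 0 ->
  (refl d F).[z] = z ^+ d * (F.[(z^*)^-1])^*.
Proof.
move=> sF z0; rewrite (horner_coef_wide _ (size_refl d F)).
rewrite (horner_coef_wide _ sF) rmorph_sum mulr_sumr /=.
rewrite (reindex_inj rev_ord_inj) /=; apply: eq_bigr => i _.
rewrite subSS coef_refl ?leq_subr // subKn ?leq_ord //.
rewrite rmorphM rmorphXn /= fmorphV /= conjCK mulrCA; congr (_ * _).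
by rewrite exprVn expfB_cond // (negbTE z0) /= leq_ord.
Qed.

Lemma circle_neq0 z : `|z| = 1 -> z != 0.
Proof. by move=> z1; rewrite -normr_eq0 z1 oner_eq0. Qed.

Lemma circle_mulC z : `|z| = 1 -> z * z^* = 1.
Proof. by move=> z1; rewrite -normCK z1 expr1n. Qed.

Lemma circle_invC z : `|z| = 1 -> (z^*)^-1 = z.
Proof.
move=> z1; apply: (mulIf (x := z^*)); first by rewrite conjC_eq0 circle_neq0.
by rewrite mulVf ?circle_mulC // conjC_eq0 circle_neq0.
Qed.

Lemma horner_refl_circle d F z : (size F <= d.+1)%N -> `|z| = 1 ->
  (refl d F).[z] = z ^+ d * (F.[z])^*.
Proof.
by move=> sF z1; rewrite horner_refl ?circle_neq0 // circle_invC.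
Qed.

Lemma refl_eq0 d F : (size F <= d.+1)%N -> refl d F = 0 -> F = 0.
Proof.
move=> sF F0; apply: poly_eq_circle => z z1; rewrite horner0.
have := horner_refl_circle sF z1; rewrite F0 horner0 => /esym/eqP.
by rewrite mulf_eq0 expf_eq0 (negbTE (circle_neq0 z1)) andbF conjC_eq0 => /eqP.
Qed.

(** A zero at s together with its mirror image 1 / conj(s); a double zero when s
    is on the circle, and for s = 0 a zero at the origin and one at infinity. *)
Definition node_factor s : {poly C} := ('X - s%:P) * (1 - s^* *: 'X).

Lemma horner_node_factor s z : (node_factor s).[z] = (z - s) * (1 - s^* * z).
Proof. by rewrite /node_factor !hornerE. Qed.

Lemma node_factor_neq0 s : node_factor s != 0.
Proof.
rewrite mulf_neq0 ?polyXsubC_eq0 //; apply/eqP => /(congr1 (fun p => p.[0])).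
by rewrite !hornerE /= => /eqP; rewrite ?mulr0 ?subr0 oner_eq0.
Qed.

Lemma node_factor_root s z : `|s| <= 1 -> `|z| <= 1 ->
  (node_factor s).[z] = 0 -> z = s.
Proof.
move=> s1 z1; rewrite horner_node_factor => /eqP.
rewrite mulf_eq0 !subr_eq0 => /orP[/eqP//|/eqP e].
have n : `|s| * `|z| = 1.
  by rewrite -[`|s|]norm_conjC -normrM -e normr1.
have s1' : `|s| = 1.
  apply/le_anti; rewrite s1 -n /=.
  by apply: ler_piMr.
by rewrite -[z]mul1r -(circle_mulC s1') -mulrA -e mulr1.
Qed.

(** The zeros of a self-reflective polynomial are symmetric in the circle, so a zero
    s in the disc comes with the zero 1 / conj(s). For s = 0 the mirror zero is at
    infinity: it lowers the degree by one. *)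
Lemma root_factor_refl d F u s : (size F <= d.+3)%N ->
  refl d.+2 F = u *: F -> F.[s] = 0 -> `|s| <= 1 ->
  (`|s| = 1 -> F^`().[s] = 0) ->
  exists F1, [/\ F = node_factor s * F1, (size F1 <= d.+1)%N
    & refl d F1 = u *: F1].
Proof.
move=> sF rF Fs s1 dF.
suff [F1 FE sF1] : exists2 F1, F = node_factor s * F1 & (size F1 <= d.+1)%N.
  exists F1; split=> //; apply: (mulfI (node_factor_neq0 s)).
  (* The node factor is its own reflection, so it cancels. *)
  rewrite -scalerAr -FE -rF; apply: poly_eq_circle => z z1.
  rewrite (hornerM (node_factor s)) !horner_refl_circle // FE.
  rewrite (hornerM (node_factor s)) horner_node_factor.
  have := circle_mulC z1; set w := z^* => zw.
  rewrite !rmorphM !rmorphB rmorph1 rmorphM /= conjCK -/w.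
  by rewrite -addn2 exprD; ring : zw.
have [->|Fnz] := eqVneq F 0; first by exists 0; rewrite ?mulr0 ?size_poly0.
have /factor_theorem[G FG] : root F s by apply/eqP.
(* At s = 0 the top coefficient of F vanishes with the constant one. *)
have [s0|s0] := eqVneq s 0.
  have FX : F = G * 'X by rewrite FG s0 polyC0 subr0.
  exists G; first by rewrite /node_factor s0 conjC0 scale0r !subr0 mulr1 mulrC.
  have unz : u != 0.
    apply: contra_neq Fnz => u0; apply: (refl_eq0 sF).
    by rewrite rF u0 scale0r.
  have F2 : F`_d.+2 = 0.
    apply: (mulfI unz); rewrite -coefZ -rF coef_refl // subnn mulr0.
    by rewrite FX coefMX /= conjC0.
  apply/leq_sizeP => j; rewrite leq_eqVlt => /orP[/eqP<-|dj].
    by have := F2; rewrite FX coefMX.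
  have /leq_sizeP/(_ j.+1 dj) := sF; by rewrite FX coefMX.
suff : G.[(s^*)^-1] = 0.
  move=> /eqP/factor_theorem[G1 GG1].
  have sc0 : s^* != 0 by rewrite conjC_eq0.
  have G1nz : G1 != 0.
    apply: contra_neq Fnz => G0; by rewrite FG GG1 G0 !mul0r.
  exists (- (s^*)^-1 *: G1).
    rewrite FG GG1 /node_factor scaleNr -!mul_polyC.
    have : ((s^*)^-1)%:P * (s^*)%:P = 1 :> {poly C} by rewrite -polyCM mulVf.
    set a := ((s^*)^-1)%:P; set b := (s^*)%:P => ab; ring : ab.
  rewrite size_scale ?oppr_eq0 ?invr_eq0 //.
  move: sF; rewrite FG GG1 !size_mul ?polyXsubC_eq0 ?mulf_neq0 ?polyXsubC_eq0 //.
  by rewrite !size_XsubC; lia.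
have [s1'|s1'] := eqVneq `|s| 1.
  rewrite circle_invC //; have := dF s1'.
  by rewrite FG derivM !hornerE subrr mulr0 add0r derivXsubC !hornerE.
have unz : u != 0.
  apply: contra_neq Fnz => u0; apply: (refl_eq0 sF).
  by rewrite rF u0 scale0r.
have sv0 : (s^*)^-1 != 0 by rewrite invr_eq0 conjC_eq0.
have : F.[(s^*)^-1] = 0.
  apply: (mulfI unz); rewrite -hornerZ -rF horner_refl //.
  by rewrite fmorphV /= conjCK invrK Fs conjC0 !mulr0.
rewrite FG !hornerE => /eqP; rewrite mulf_eq0 => /orP[/eqP//|].
rewrite subr_eq0 => /eqP e; case/eqP: s1'.
have : `|s| ^+ 2 = 1 by rewrite normCK -{1}e mulVf // conjC_eq0.
by move/eqP; rewrite expr2 -expr2 sqrf_eq1 => /orP[/eqP//|/eqP h];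
  have := normr_ge0 s; rewrite h ler0N1.
Qed.

Lemma roots_factor_refl d (l : seq C) F u : uniq l ->
  (size F <= (2 * size l + d).+1)%N ->
  refl (2 * size l + d) F = u *: F ->
  (forall s, s \in l -> [/\ F.[s] = 0, `|s| <= 1 & `|s| = 1 -> F^`().[s] = 0]) ->
  exists2 F1, F = \prod_(s <- l) node_factor s * F1 & (size F1 <= d.+1)%N.
Proof.
elim: l F => [|s l IH] F /=.
  by move=> _ sF _ _; exists F; rewrite // big_nil mul1r.
move=> /andP[sl ul]; rewrite mulnS -addnA add2n => sF rF hl.
have [Fs s1 dFs] := hl s (mem_head _ _).
have [F1 [FE sF1 rF1]] := root_factor_refl sF rF Fs s1 dFs.
have [] := IH F1 ul sF1 rF1.
  move=> t tl; have [|Ft t1 dFt] := hl t; first by rewrite inE tl orbT.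
  have nt : (node_factor s).[t] != 0.
    apply: contraNneq sl => e.
    by rewrite -(node_factor_root s1 t1 e).
  have F1t : F1.[t] = 0.
    by apply: (mulfI nt); rewrite mulr0 -hornerM -FE.
  split=> // /dFt; rewrite FE derivM hornerD (hornerM _ F1).
  rewrite (hornerM (node_factor s)) F1t mulr0 add0r => /eqP.
  by rewrite mulf_eq0 (negbTE nt) => /eqP.
by move=> F2 F1E sF2; exists F2 => //; rewrite big_cons FE F1E mulrA.
Qed.

End Reflection.

(** * Quotients of polynomials that are unimodular on the circle *)

Section Structure.
Variable C : numClosedFieldType.
Implicit Types (D E F G M N : {poly C}) (z s c : C) (d m : nat).

Lemma root_refl d F z : (size F <= d.+1)%N -> z != 0 ->
  root (refl d F) z = root F (z^*)^-1.
Proof.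
move=> sF z0; rewrite !rootE horner_refl // mulf_eq0 expf_eq0 (negbTE z0).
by rewrite andbF conjC_eq0.
Qed.

(** A common zero of the reflections would be the mirror image of a common zero
    of M and N, or the origin; the latter is excluded because one of M, N has
    degree exactly d. *)
Lemma coprimep_refl d M N : coprimep N M -> maxn (size N) (size M) = d.+1 ->
  coprimep (refl d M) (refl d N).
Proof.
move=> /Pdiv.ClosedField.coprimepP cNM e.
have sN : (size N <= d.+1)%N by rewrite -e leq_maxl.
have sM : (size M <= d.+1)%N by rewrite -e leq_maxr.
apply/Pdiv.ClosedField.coprimepP => w.
have [->|w0] := eqVneq w 0; last first.
  rewrite !root_refl // => rM; rewrite -rootE root_refl //.
  by apply/negP => /cNM; rewrite -rootE rM.
rewrite !rootE !horner_coef0 !coef_refl // subn0 !conjC_eq0 => /eqP M0.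
apply/negP => /eqP N0; move: e; rewrite maxnE => e.
have size_small G : (size G <= d.+1)%N -> G`_d = 0 -> (size G <= d)%N.
  move=> sG G0; apply/leq_sizeP => j; rewrite leq_eqVlt => /orP[/eqP<- //|].
  by move/leq_sizeP: sG; apply.
have := size_small _ sN N0; have := size_small _ sM M0; lia.
Qed.

(** On the circle |N| = |M| reads N N~ = M M~, an identity of polynomials. By
    coprimality of N with M, and of N~ with M~, N and M~ divide each other. *)
Lemma unimodular_quotient_refl d M N : coprimep N M ->
  maxn (size N) (size M) = d.+1 ->
  (forall z, `|z| <= 1 -> M.[z] != 0) ->
  (forall z, `|z| = 1 -> `|N.[z]| = `|M.[z]|) ->
  exists2 c, `|c| = 1 & N = c *: refl d M.
Proof.
move=> cNM e M0 NM.
have sN : (size N <= d.+1)%N by rewrite -e leq_maxl.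
have sM : (size M <= d.+1)%N by rewrite -e leq_maxr.
have eNM : N * refl d N = M * refl d M.
  apply: poly_eq_circle => z z1; rewrite !hornerM !horner_refl_circle //.
  by rewrite ![_ * (z ^+ d * _)]mulrCA -!normCK NM.
have : N %= refl d M.
  rewrite /eqp -(Gauss_dvdpr _ cNM) -eNM dvdp_mulr //=.
  rewrite -(Gauss_dvdpl N (coprimep_refl cNM e)) eNM.
  exact: dvdp_mulIr.
case/eqpP => -[a b] /= /andP[a0 b0] eab.
have NE : N = (b / a) *: refl d M.
  by rewrite mulrC -scalerA -eab scalerA mulVf // scale1r.
exists (b / a) => //; have n1 : `|1 : C| = 1 by rewrite normr1.
have := NM 1 n1; rewrite {1}NE hornerZ horner_refl_circle // expr1n mul1r.
rewrite normrM norm_conjC -[RHS]mul1r; apply: mulIf.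
by rewrite normr_eq0 M0 // n1.
Qed.

(** The zeros of the reflection of F are all in the open disc. *)
Lemma coprimep_refl_self d G F : (forall z, `|z| <= 1 -> F.[z] != 0) ->
  (forall z, `|z| <= 1 -> G.[z] != 0) ->
  (size F <= d.+1)%N -> coprimep G (refl d F).
Proof.
move=> F0 G0 sF; apply/Pdiv.ClosedField.coprimepP => w /eqP Gw.
have w1 : ~~ (`|w| <= 1) by apply/negP => /G0; rewrite Gw eqxx.
have w0 : w != 0 by apply: contraNneq w1 => ->; rewrite normr0 ler01.
rewrite -rootE root_refl // rootE F0 // normfV norm_conjC invf_le1 ?normr_gt0 //.
by apply: ltW; rewrite real_ltNge ?realn // ?normr_real.
Qed.

(** This is applied to s = Es / Ds and p = N / D, where the identity on the circle
    is s = conj(s) p. As Ds is prime to its own reflection, the identity makes Ds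
    divide D; so D is a common denominator, and comparing degrees in
    E = c z^m conj(E) bounds the degree of E. *)
Lemma conj_quotient_refl m c N D Es Ds : coprimep Es Ds ->
  (forall z, `|z| <= 1 -> Ds.[z] != 0) ->
  (forall z, `|z| <= 1 -> D.[z] != 0) ->
  (size D <= m.+1)%N -> `|c| = 1 -> N = c *: refl m D ->
  (forall z, `|z| = 1 ->
     Es.[z] * D.[z] * (Ds.[z])^* = (Es.[z])^* * N.[z] * Ds.[z]) ->
  exists E, [/\ Es * D = E * Ds, (size E <= m.+1)%N & E = c *: refl m E].
Proof.
move=> cED Ds0 D0 sD c1 NE eb.
pose a := maxn (size Es) (size Ds).
have sEs : (size Es <= a.+1)%N by rewrite leqW // leq_maxl.
have sDs : (size Ds <= a.+1)%N by rewrite leqW // leq_maxr.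
have : Ds %| D.
  rewrite -(Gauss_dvdpl D (coprimep_refl_self Ds0 Ds0 sDs)).
  rewrite -(Gauss_dvdpr _ (q := Es)); last by rewrite coprimep_sym.
  have -> : Es * (D * refl a Ds) = refl a Es * N * Ds.
    apply: poly_eq_circle => z z1; rewrite !hornerM !horner_refl_circle //.
    have := eb z z1; set x := (Ds.[z])^*; set y := (Es.[z])^* => ez.
    by ring : ez.
  exact: dvdp_mulIr.
move=> /dvdpP[q DE]; exists (Es * q).
have circ z : `|z| = 1 -> (Es * q).[z] = c * (z ^+ m * ((Es * q).[z])^*).
  move=> z1; have Dsz : Ds.[z] != 0 by rewrite Ds0 // z1.
  have Dsz' : (Ds.[z])^* != 0 by rewrite conjC_eq0.
  apply: (mulIf Dsz); apply: (mulIf Dsz').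
  have := eb z z1; rewrite NE hornerZ horner_refl_circle // DE !hornerM.
  rewrite !rmorphM /=; move: ((Ds.[z])^*) ((Es.[z])^*) ((q.[z])^*) => x y w ez.
  by ring : ez.
have sE : (size (Es * q)%R <= m.+1)%N.
  rewrite leqNgt; apply/negP => mE.
  pose b := (size (Es * q)%R).-1.
  have sE : size (Es * q)%R = b.+1 by rewrite prednK // (leq_trans _ mE).
  (* If E had degree b > m, the left side would have degree above b. *)
  have : 'X^(b - m) * (Es * q) = c *: refl b (Es * q)%R.
    apply: poly_eq_circle => z z1; rewrite hornerZ horner_refl_circle ?sE //.
    rewrite hornerM hornerXn {1}circ // mulrCA [z ^+ _ * (_ * _)]mulrA -exprD subnK //; lia.
  move=> /(congr1 (fun p : {poly C} => size p)).
  have E0 : Es * q != 0 by rewrite -size_poly_gt0 sE.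
  rewrite mulrC size_mulXn // sE size_scale ?circle_neq0 // => e.
  by move: mE (size_refl b (Es * q)%R); rewrite -e sE; lia.
split=> //; first by rewrite DE mulrA.
by apply: poly_eq_circle => z z1; rewrite hornerZ horner_refl_circle // -circ.
Qed.

End Structure.

(** * Rational functions in lowest terms *)

Section Fractions.
Variable R : idomainType.
Local Notation tofrac := (@FracField.tofrac R).
Import generic_quotient.

Lemma frac_reprE (f : {fraction R}) :
  f = tofrac (fraction.frac (repr f)).1 / tofrac (fraction.frac (repr f)).2.
Proof.
set r := repr f.
have d0 : (fraction.frac r).2 != 0 by exact: denom_ratioP.
apply: (mulIf (x := tofrac (fraction.frac r).2)).
  by rewrite tofrac_eq0.
rewrite divfK ?tofrac_eq0 //.
rewrite -[f]reprK -/r.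
rewrite [LHS](_ : _ = FracField.mul (pi (FracField.type R) r) (tofrac (fraction.frac r).2)) //.
rewrite !piE; apply/eqmodP; rewrite /= FracField.equivfE /FracField.mulf.
by rewrite !numden_Ratio ?(oner_eq0, mulf_neq0, denom_ratioP) // !mulr1 mulrC.
Qed.
End Fractions.

Section RationalFunctions.
Variable R : realType.
Local Notation C := R[i].
Local Notation tofrac := (@FracField.tofrac {poly C}).
Implicit Types (f : ratfun R) (N M : {poly C}).

Lemma rden_neq0 f : rden f != 0.
Proof.
rewrite /rden; set r := fraction.frac _.
have r0 : r.2 != 0 by exact: denom_ratioP.
by rewrite dvdp_div_eq0 ?dvdp_gcdr.
Qed.

Lemma coprimep_rnum_rden f : coprimep (rnum f) (rden f).
Proof.
rewrite /rden /rnum; set r := fraction.frac _.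
have r0 : r.2 != 0 by exact: denom_ratioP.
by rewrite coprimep_div_gcd // r0 orbT.
Qed.

Lemma ratfunE f : f = tofrac (rnum f) / tofrac (rden f).
Proof.
rewrite [LHS]frac_reprE /rnum /rden; set r := fraction.frac _.
have r0 : r.2 != 0 by exact: denom_ratioP.
have g0 : gcdp r.1 r.2 != 0 by rewrite gcdp_eq0 (negbTE r0) andbF.
have n1 := divpK (dvdp_gcdl r.1 r.2); have d1 := divpK (dvdp_gcdr r.1 r.2).
move: g0 n1 d1; set g := gcdp r.1 r.2 => g0 n1 d1.
rewrite -[in LHS]n1 -[in LHS]d1 !tofracM -mulf_div divff ?mulr1 //.
by rewrite tofrac_eq0.
Qed.

(** Lowest terms are unique up to a scalar, so that rational functions can be
    evaluated through any coprime representation. *)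
Lemma rnum_rden_unique f N M : M != 0 -> coprimep N M ->
  f = tofrac N / tofrac M ->
  exists2 a : C, a != 0 & rnum f = a *: N /\ rden f = a *: M.
Proof.
move=> M0 cNM; rewrite [f in f = _]ratfunE => /eqP.
rewrite eqr_div ?tofrac_eq0 ?rden_neq0 // -!tofracM tofrac_eq => /eqP e.
have cf := coprimep_rnum_rden f.
have : rden f %= M.
  rewrite /eqp -(Gauss_dvdpr _ (q := rnum f)); last by rewrite coprimep_sym.
  rewrite e dvdp_mulIr /= -(Gauss_dvdpr _ (q := N)); last by rewrite coprimep_sym.
  by rewrite -e dvdp_mulIr.
move=> /eqpP[[a b]] /= /andP[a0 b0] eab.
have dE : rden f = (b / a) *: M.
  by rewrite mulrC -scalerA -eab scalerA mulVf // scale1r.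
exists (b / a); first by rewrite mulf_neq0 ?invr_eq0.
split=> //; apply: (mulIf M0); rewrite e dE -scalerAr -scalerAl; congr (_ *: _).
Qed.

Lemma reval_div N M f z : M != 0 -> coprimep N M ->
  f = tofrac N / tofrac M -> reval f z = N.[z] / M.[z].
Proof.
move=> M0 cNM /(rnum_rden_unique M0 cNM)[a a0 [nE dE]].
by rewrite /reval nE dE !hornerZ -mulf_div divff // mul1r.
Qed.

Lemma rdegree_div N M f : M != 0 -> coprimep N M ->
  f = tofrac N / tofrac M -> rdegree f = (maxn (size N) (size M)).-1.
Proof.
move=> M0 cNM /(rnum_rden_unique M0 cNM)[a a0 [nE dE]].
by rewrite /rdegree nE dE !size_scale.
Qed.
End RationalFunctions.

(** * The parametrisation of the circle by angles *)

Section Exponential.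
Variable R : realType.
Local Notation C := R[i].
Implicit Types (s t : R) (z : C).

Lemma normcR z : `|z| = (Normc.normc z)%:C%C.
Proof. by []. Qed.

Lemma norm_expi t : `|expi t| = 1.
Proof. by rewrite normc_def /= cos2Dsin2 sqrtr1. Qed.

Lemma expi0 : expi (0 : R) = 1.
Proof. by rewrite /expi cos0 sin0. Qed.

Lemma expiD s t : expi (s + t) = expi s * expi t.
Proof.
apply/eqP; rewrite eq_complex /= cosD sinD eqxx /=.
by rewrite addrC [sin s * _]mulrC [X in _ + X]mulrC addrC mulrC [cos t * _]mulrC.
Qed.

Lemma expiN t : expi (- t) = (expi t)^*.
Proof. by rewrite /expi cosN sinN. Qed.

Lemma expiMn t n : expi (n%:R * t) = expi t ^+ n.
Proof.
elim: n => [|n IH]; first by rewrite mul0r expi0.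
by rewrite -addn1 natrD mulrDl mul1r expiD IH exprD.
Qed.

Lemma expi_2pi : expi (pi *+ 2 : R) = 1.
Proof. by rewrite /expi cos2pi sin2pi. Qed.

(** Angles are taken in a compact interval for the sake of [homotopy_has_lift]. *)
Lemma expi_surj z : `|z| = 1 -> exists2 t, - pi <= t <= pi & z = expi t.
Proof.
case: z => x y; rewrite normc_def /= => -[/(congr1 (fun x => x ^+ 2))].
rewrite expr1n sqr_sqrtr ?addr_ge0 ?sqr_ge0 // => xy.
have x1 : -1 <= x <= 1.
  rewrite -ler_norml -(@ler_pXn2r _ 2) ?nnegrE ?normr_ge0 ?ler01 //.
  by rewrite real_normK ?num_real // expr1n -xy lerDl sqr_ge0.
have yE : sin (acos x) = `|y|.
  by rewrite sin_acos // -xy [x ^+ 2 + _]addrC addrK sqrtr_sqr.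
have xE : cos (acos x) = x by apply: acosK; rewrite in_itv.
have a0 := acos_ge0 x1; have api := acos_lepi x1.
have [y0|y0] := leP 0 y.
  exists (acos x); first by rewrite api andbT; lra.
  by rewrite /expi xE yE ger0_norm.
exists (- acos x); first by lra.
by rewrite /expi cosN sinN xE yE ltr0_norm // opprK.
Qed.

Lemma expi_inj01 s t : 0 <= s <= 1 -> 0 <= t <= 1 -> expi s = expi t -> s = t.
Proof.
move=> s01 t01 [cE _]; have := pi_ge2 R => pi2.
by apply: cos_inj cE; rewrite in_itv /=; lra.
Qed.
End Exponential.

(** * Limits of complex-valued functions *)

Section ComplexTopology.
Variable R : realType.
Local Notation C := R[i].
Local Notation normc := (@Normc.normc R).
Implicit Types (z : C) (x : R).

Lemma normc_ge0 z : 0 <= normc z.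
Proof. by rewrite -lecR -normcR normr_ge0. Qed.

Lemma normc_sqrtE z : normc z = Num.sqrt (complex.Re z ^+ 2 + complex.Im z ^+ 2).
Proof. by case: z. Qed.

Lemma normc_sqr z : normc z ^+ 2 = complex.Re z ^+ 2 + complex.Im z ^+ 2.
Proof. by rewrite normc_sqrtE sqr_sqrtr // addr_ge0 ?sqr_ge0. Qed.

Lemma norm_Re_le z : `|complex.Re z| <= normc z.
Proof.
by rewrite normc_sqrtE -sqrtr_sqr ler_wsqrtr // lerDl sqr_ge0.
Qed.

Lemma norm_Im_le z : `|complex.Im z| <= normc z.
Proof.
by rewrite normc_sqrtE -sqrtr_sqr ler_wsqrtr // lerDr sqr_ge0.
Qed.

Lemma normc_le_ReIm z : normc z <= `|complex.Re z| + `|complex.Im z|.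
Proof.
rewrite -(@ler_pXn2r _ 2) ?nnegrE ?normc_ge0 ?addr_ge0 //.
rewrite normc_sqr sqrrD !real_normK ?num_real // -addrA lerD2l lerDr.
by rewrite mulrn_wge0 // mulr_ge0.
Qed.

Section Filters.
Context {T : Type} {F : set_system T} {FF : Filter F}.
Implicit Types (f : T -> C) (l : C).

Lemma cvg_normcP f l : f @ F --> l <->
  forall e : R, 0 < e -> \forall t \near F, normc (l - f t) < e.
Proof.
split=> [/cvgrPdist_lt h e e0|h]; last apply/cvgrPdist_lt => e e0.
  have := h e%:C%C; rewrite ltcR => /(_ e0); apply: filterS => t.
  by rewrite normcR ltcR.
have e1 : e = (complex.Re e)%:C%C by rewrite RRe_real // realE ltW.
move: e0; rewrite e1 ltcR => /h; apply: filterS => t.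
by rewrite normcR ltcR.
Qed.

Lemma cvg_ReIm f l : (fun t => complex.Re (f t)) @ F --> complex.Re l ->
  (fun t => complex.Im (f t)) @ F --> complex.Im l -> f @ F --> l.
Proof.
move=> /cvgrPdist_lt hR /cvgrPdist_lt hI; apply/cvg_normcP => e e0.
have e2 : 0 < e / 2 by rewrite divr_gt0.
apply: filterS2 (hR _ e2) (hI _ e2) => t h1 h2.
apply: le_lt_trans (normc_le_ReIm _) _; rewrite [ltRHS]splitr raddfB raddfB.
exact: ltrD.
Qed.

Lemma cvg_Re f l : f @ F --> l -> (fun t => complex.Re (f t)) @ F --> complex.Re l.
Proof.
move=> /cvg_normcP h; apply/cvgrPdist_lt => e /h; apply: filterS => t.
by apply: le_lt_trans; rewrite -raddfB norm_Re_le.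
Qed.

Lemma cvg_Im f l : f @ F --> l -> (fun t => complex.Im (f t)) @ F --> complex.Im l.
Proof.
move=> /cvg_normcP h; apply/cvgrPdist_lt => e /h; apply: filterS => t.
by apply: le_lt_trans; rewrite -raddfB norm_Im_le.
Qed.

Lemma cvg_conjC f l : f @ F --> l -> (fun t => (f t)^*) @ F --> l^*.
Proof.
have ReC z : complex.Re z^* = complex.Re z by case: z.
have ImC z : complex.Im z^* = - complex.Im z by case: z.
move=> fl; apply: cvg_ReIm.
  by under eq_fun do rewrite ReC; rewrite ReC; exact: cvg_Re.
by under eq_fun do rewrite ImC; rewrite ImC; apply: cvgN; exact: cvg_Im.
Qed.

Lemma cvg_normc f l : f @ F --> l -> (fun t => normc (f t)) @ F --> normc l.
Proof.
move=> /cvg_normcP h; apply/cvgrPdist_lt => e /h; apply: filterS => t.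
apply: le_lt_trans; rewrite -lecR -normcR.
by have := lerB_dist l (f t); have := lerB_dist (f t) l;
  rewrite distrC !normcR -!rmorphB /= !lecR ler_norml; lra.
Qed.
End Filters.

Lemma continuous_expi : continuous (@expi R).
Proof.
by move=> t; apply: cvg_ReIm; [exact: continuous_cos|exact: continuous_sin].
Qed.

Lemma cvg_real_complex x : (fun r : R => r%:C%C) @ x --> x%:C%C.
Proof. by apply: cvg_ReIm => /=; [exact: cvg_id|exact: cvg_cst]. Qed.

Implicit Types (P N : {poly C}).

Lemma derivable_hornerC P z : derivable (horner P : C -> C) z 1.
Proof.
elim/poly_ind: P => [|P c IH].
  rewrite (_ : horner 0 = cst 0); first exact: derivable_cst.
  by apply/funext => w; rewrite horner0.
rewrite (_ : horner (P * 'X + c%:P) = (horner P * id) \+ cst c); last first.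
  by apply/funext => w; rewrite hornerMXaddC.
apply: derivableD; last exact: derivable_cst.
by apply: derivableM; [exact: IH|exact: derivable_id].
Qed.

Lemma continuous_hornerC P : continuous (horner P : C -> C).
Proof.
by move=> z; apply: differentiable_continuous; apply/derivable1_diffP; exact: derivable_hornerC.
Qed.

Lemma derivable_divC N P z : P.[z] != 0 ->
  derivable (fun w : C => N.[w] / P.[w]) z 1.
Proof.
move=> Pz; apply: derivableM; first exact: derivable_hornerC.
by apply: derivableV => //; exact: derivable_hornerC.
Qed.
End ComplexTopology.

(** * Boundary values of bounded rational functions *)

Section Bounded.
Variable R : realType.
Local Notation C := R[i].
Local Notation normc := (@Normc.normc R).
Implicit Types (z : C) (F : {poly C}).

Lemma normc_real (x : R) : normc x%:C%C = `|x|.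
Proof. by rewrite normc_sqrtE /= expr0n /= addr0 sqrtr_sqr. Qed.

Lemma normc1P z : `|z| = 1 <-> normc z = 1.
Proof. by rewrite normcR; split=> [[]|->]. Qed.

Lemma discP z : disc z <-> normc z < 1.
Proof. by rewrite /disc /= normcR ltcR. Qed.

Lemma cdiscP z : cdisc z <-> normc z <= 1.
Proof. by rewrite /cdisc /= normcR lecR. Qed.

(** Close to a pole z the quotient exceeds any bound wherever it is defined, so the
    denominator would vanish on a whole segment of the disc ending at z. At the poles
    themselves [reval] is 0, and there the hypothesis gives nothing. *)
Lemma bounded_no_pole (f : ratfun R) (B : R) :
  (forall z, disc z -> normc (reval f z) <= B) ->
  forall z, `|z| <= 1 -> (rden f).[z] != 0.
Proof.
move=> fB z z1; apply/negP => /eqP Mz.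
have Nz : (rnum f).[z] != 0.
  apply/negP => Nz; have := coprimep_rnum_rden f.
  by move=> /Pdiv.ClosedField.coprimepP/(_ z Nz); rewrite Mz eqxx.
(* The segment from z to v runs in the open disc, except perhaps for z. *)
have [v [vz v1]] : exists v, v != z /\ disc v.
  have [->|z0] := eqVneq z 0.
    exists ((2^-1 : R)%:C%C); split.
      by rewrite -[0]/(0%:C)%C; apply/eqP => /complexI/eqP; rewrite invr_eq0 pnatr_eq0.
    by apply/discP; rewrite normc_real ger0_norm ?invr_ge0 // invf_lt1 ?ltr1n.
  by exists 0; rewrite eq_sym; split=> //; apply/discP; rewrite Normc.normc0.
pose w (r : R) := z + r%:C%C * (v - z).
have wcont (F : {poly C}) : (fun r => F.[w r]) @ (0 : R) --> F.[z].
  have -> : F.[z] = F.[w 0] by rewrite /w mul0r addr0.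
  apply: (@continuous_comp _ _ _ w (horner F)); last exact: continuous_hornerC.
  apply: cvgD; first exact: cvg_cst.
  by apply: cvgM; [exact: cvg_real_complex|exact: cvg_cst].
have near0 : \forall r \near (0 : R),
    0 < normc (rnum f).[w r] - B * normc (rden f).[w r].
  have : (fun r => normc (rnum f).[w r] - B * normc (rden f).[w r]) @ (0 : R)
      --> normc (rnum f).[z] - B * normc (rden f).[z].
    apply: cvgB; first exact: cvg_normc (wcont _).
    by apply: cvgM; [exact: cvg_cst|exact: cvg_normc (wcont _)].
  rewrite Mz Normc.normc0 mulr0 subr0 => h; apply: (cvgr_gt _ h).
  rewrite lt_neqAle normc_ge0 andbT eq_sym; apply/negP => /eqP.
  by move=> /Normc.eq0_normc/eqP; apply/negP.
have [e /= e0 he] : exists2 e : R, 0 < e &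
    forall r, `|r| < e -> 0 < normc (rnum f).[w r] - B * normc (rden f).[w r].
  case/nbhs_ballP: near0 => e /= e0 he; exists e => // r re.
  by apply: he; rewrite /ball /= sub0r normrN.
have wdisc r : 0 < r < 1 -> disc (w r).
  move=> /andP[r0 r1]; apply/discP.
  have -> : w r = (1 - r)%:C%C * z + r%:C%C * v by rewrite /w rmorphB rmorph1 /=; ring.
  apply: le_lt_trans (le_normcD _ _) _; rewrite !Normc.normcM !normc_real.
  rewrite (gtr0_norm r0) ger0_norm ?subr_ge0 ?ltW //.
  have z1' : normc z <= 1 by apply/cdiscP.
  have v1' : normc v < 1 by apply/discP.
  rewrite -[ltRHS](subrK r); apply: ler_ltD.
    by rewrite ler_piMr // subr_ge0 ltW.
  by rewrite gtr_pMr.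
pose d := Num.min e 1; have d0 : 0 < d by rewrite lt_min e0 ltr01.
pose g (k : nat) := w (d / k.+2%:R).
suff /eqP : rden f = 0 by apply/negP; exact: rden_neq0.
apply: (@poly_eq0_inj _ _ g) => [j k|k].
  move=> /addrI/mulIf; rewrite subr_eq0 => /(_ vz)/complexI/mulfI.
  by rewrite gt_eqF // => /(_ isT)/invr_inj/eqP; rewrite eqr_nat => /eqP[].
have gk : 0 < d / k.+2%:R < d.
  by rewrite divr_gt0 //= gtr_pMr // invf_lt1 // ltr1n.
have dk : 0 < d / k.+2%:R < 1.
  by case/andP: gk => -> /= /lt_le_trans; apply; rewrite ge_min lexx orbT.
apply/eqP/negPn/negP => Mk.
have := fB _ (wdisc _ dk); rewrite /reval Normc.normcM Normc.normcV.
rewrite ler_pdivrMr; last first.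
  rewrite lt_neqAle normc_ge0 andbT eq_sym; apply/negP => /eqP.
  by move=> /Normc.eq0_normc/eqP; apply/negP.
rewrite -subr_le0 leNgt he //; case/andP: gk => h1 h2.
by rewrite gtr0_norm //; apply: lt_le_trans h2 _; rewrite ge_min lexx.
Qed.

(** A nonzero polynomial has finitely many zeros, whereas a set of full measure of
    angles meets [0, 1] in an infinite set. *)
Lemma ae_poly_eq0 F :
  {ae (@lebesgue_measure R), forall t : R, F.[expi t] = 0} -> F = 0.
Proof.
move=> aeF; apply/eqP/negPn/negP => nz.
pose S := [set t : R | 0 <= t <= 1 /\ F.[expi t] = 0].
have finS : finite_set S.
  rewrite -(eq_finite_set (@inj_card_eq _ _ S (@expi R) _)); last first.
    move=> s t /set_mem[s01 _] /set_mem[t01 _]; exact: expi_inj01.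
  have [r Fr] := closed_field_poly_normal F.
  apply: (@sub_finite_set _ _ [set` r]); last exact: finite_seq.
  move=> _ [t [_ Ft] <-] /=.
  have : root F (expi t) by rewrite rootE Ft.
  by rewrite Fr rootZ ?lead_coef_eq0 // root_prod_XsubC.
have negS : (@lebesgue_measure R).-negligible S.
  exists S; split=> //; last first.
    exact: countable_lebesgue_measure0 (finite_set_countable finS).
  exact: countable_measurable (finite_set_countable finS).
have : (@lebesgue_measure R).-negligible `[0, 1]%classic.
  apply: negligibleS (negligibleU negS aeF) => t /=; rewrite in_itv /= => t01.
  by have [Ft|Ft] := pselect (F.[expi t] = 0); [left|right].
move=> /measure_negligible => /(_ (measurable_itv _)) m0.
have := lebesgue_measure_itv `[0 : R, 1].
rewrite [LHS]m0 /= lte_fin ltr01 oppr0 adde0 => -[/esym/eqP].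
by rewrite oner_eq0.
Qed.
End Bounded.

Section Boundary.
Variable R : realType.
Local Notation C := R[i].
Local Notation normc := (@Normc.normc R).
Implicit Types (z : C) (F : {poly C}) (f phi : ratfun R) (t : R).

Lemma ae_impl (P Q : R -> Prop) : (forall t, P t -> Q t) ->
  {ae (@lebesgue_measure R), forall t : R, P t} ->
  {ae (@lebesgue_measure R), forall t : R, Q t}.
Proof. by move=> PQ; apply: negligibleS => t /= nQ /PQ. Qed.

Lemma continuous_reval f z : (rden f).[z] != 0 ->
  {for z, continuous (reval f)}.
Proof.
move=> Mz; apply: differentiable_continuous; apply/derivable1_diffP.
exact: derivable_divC.
Qed.

Lemma radial_limit_reval f t : (rden f).[expi t] != 0 ->
  radial_limit (reval f) t (reval f (expi t)).
Proof.
move=> Mt; rewrite /radial_limit.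
have : {for (1 : R), continuous (fun r : R => reval f (r%:C%C * expi t))}.
  apply: (@continuous_comp _ _ _ (fun r : R => r%:C%C * expi t) (reval f)).
    by apply: cvgM; [exact: cvg_real_complex|exact: cvg_cst].
  by rewrite mul1r; exact: continuous_reval.
by move=> /cvg_at_left_filter; rewrite mul1r.
Qed.

Lemma radial_limit_unique f t l : (rden f).[expi t] != 0 ->
  radial_limit (reval f) t l -> l = reval f (expi t).
Proof.
move=> Mt h1; have h2 := radial_limit_reval Mt.
exact: (cvg_unique _ h1 h2).
Qed.

Lemma normC_eq_mulC (x y : C) : (`|x| = `|y|) <-> x * x^* = y * y^*.
Proof.
rewrite -!normCK; split=> [->//|/eqP].
by rewrite eqrXn2 // => /eqP.
Qed.

Lemma ae_circle_norm_eq N M :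
  {ae (@lebesgue_measure R), forall t : R, `|N.[expi t]| = `|M.[expi t]| :> C} ->
  forall z, `|z| = 1 -> `|N.[z]| = `|M.[z]|.
Proof.
move=> ae; pose d := maxn (size N) (size M).
have sN : (size N <= d.+1)%N by rewrite leqW // leq_maxl.
have sM : (size M <= d.+1)%N by rewrite leqW // leq_maxr.
have /eqP : N * refl d N - M * refl d M = 0.
  apply: ae_poly_eq0; apply: ae_impl ae => t /normC_eq_mulC e.
  have z1 := norm_expi t; rewrite hornerD hornerN !hornerM !horner_refl_circle //.
  by rewrite ![_ * (expi t ^+ d * _)]mulrCA e subrr.
rewrite subr_eq0 => /eqP e z z1; apply/normC_eq_mulC.
have zd : z ^+ d != 0 by rewrite expf_neq0 // circle_neq0.
apply: (mulfI zd); have := congr1 (fun p : {poly C} => p.[z]) e.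
by rewrite !hornerM !horner_refl_circle // ![_ * (z ^+ d * _)]mulrCA.
Qed.

Lemma ae_circle_conj_eq Es D Ds N :
  {ae (@lebesgue_measure R), forall t : R, let z := expi t in
    Es.[z] * D.[z] * (Ds.[z])^* = (Es.[z])^* * N.[z] * Ds.[z] :> C} ->
  forall z : C, `|z| = 1 ->
    Es.[z] * D.[z] * (Ds.[z])^* = (Es.[z])^* * N.[z] * Ds.[z].
Proof.
move=> ae; pose a := maxn (size Es) (size Ds).
have sE : (size Es <= a.+1)%N by rewrite leqW // leq_maxl.
have sD : (size Ds <= a.+1)%N by rewrite leqW // leq_maxr.
have H z : `|z| = 1 -> (Es * D * refl a Ds - refl a Es * N * Ds).[z] =
    z ^+ a * (Es.[z] * D.[z] * (Ds.[z])^* - (Es.[z])^* * N.[z] * Ds.[z]).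
  by move=> z1; rewrite hornerD hornerN !hornerM !horner_refl_circle //; ring.
have e : Es * D * refl a Ds - refl a Es * N * Ds = 0.
  apply: ae_poly_eq0; apply: ae_impl ae => t /= e.
  by rewrite H ?norm_expi // e subrr mulr0.
move=> z z1; have := H z z1; rewrite e horner0 => /esym/eqP.
rewrite mulf_eq0 expf_eq0 (negbTE (circle_neq0 z1)) andbF /= subr_eq0.
by move/eqP.
Qed.

Lemma leq_size_rdegree f : (size (rnum f) <= (rdegree f).+1)%N /\
  (size (rden f) <= (rdegree f).+1)%N /\
  maxn (size (rnum f)) (size (rden f)) = (rdegree f).+1.
Proof.
have := rden_neq0 f; rewrite -size_poly_gt0 /rdegree; lia.
Qed.

(** The structure theorem for rational inner functions: they are the quotients c M~ / M
    with M free of zeros in the closed disc. *)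
Lemma inner_refl phi : (forall z, disc z -> cdisc (reval phi z)) ->
  {ae (@lebesgue_measure R), forall t : R,
     exists2 l, circle l & radial_limit (reval phi) t l} ->
  (forall z, `|z| <= 1 -> (rden phi).[z] != 0) /\
  exists2 c, `|c| = 1 & rnum phi = c *: refl (rdegree phi) (rden phi).
Proof.
move=> bd ae.
have D0 : forall z, `|z| <= 1 -> (rden phi).[z] != 0.
  apply: (@bounded_no_pole _ phi 1) => z /bd; exact: (cdiscP _).1.
split=> //; have [_ [_ e]] := leq_size_rdegree phi.
apply: unimodular_quotient_refl => //; first exact: coprimep_rnum_rden.
apply: ae_circle_norm_eq; apply: ae_impl ae => t [l l1].
have Mt : (rden phi).[expi t] != 0 by rewrite D0 // norm_expi.
move=> /(radial_limit_unique Mt) le; move: l1; rewrite /circle /= le /reval.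
rewrite normf_div => /(congr1 (fun x => x * `|(rden phi).[expi t]|)).
by rewrite mulfVK ?mul1r // normr_eq0.
Qed.

Lemma Gamma_bounds (x : C * C) : Gamma x -> `|x.1| <= 2 /\ `|x.2| <= 1.
Proof.
move=> [z [w [z1 w1 ->]]] /=; split.
  by apply: le_trans (ler_normD _ _) _; rewrite -[2]/(1 + 1) lerD.
by rewrite normrM mulr_ile1.
Qed.

(** For |z| = |w| = 1 one has conj(z + w) z w = w + z. *)
Lemma bGamma_conj (x : C * C) : bGamma x -> `|x.2| = 1 /\ x.1 = (x.1)^* * x.2.
Proof.
move=> [z [w [z1 w1 ->]]] /=; split; first by rewrite normrM z1 w1 mulr1.
have := circle_mulC z1; have := circle_mulC w1; rewrite rmorphD /=.
by move: (z^*) (w^*) => a b wb za; ring: wb za.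
Qed.

(** The structure theorem for rational Gamma-inner functions: both components have
    the denominator D of the second one, and the numerators N and E satisfy
    N = c D~ and E = c E~ with the same c. *)
Lemma Gamma_inner_refl (h : ratfun R * ratfun R) : rational_Gamma_inner h ->
  let m := rdegree h.2 in let D := rden h.2 in let N := rnum h.2 in
  (forall z, `|z| <= 1 -> D.[z] != 0) /\
  exists (c : C) (E : {poly C}), [/\ `|c| = 1, N = c *: refl m D, (size E <= m.+1)%N,
    E = c *: refl m E &
    h.1 = FracField.tofrac E / FracField.tofrac D /\
    forall z, `|z| <= 1 -> reval h.1 z = E.[z] / D.[z]].
Proof.
move=> [_ _ hG ae] m D N.
have [D0 [c c1 NE]] : (forall z, `|z| <= 1 -> D.[z] != 0) /\
    exists2 c, `|c| = 1 & N = c *: refl m D.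
  apply: inner_refl => [z /hG/Gamma_bounds[]//|].
  apply: ae_impl ae => t [l /bGamma_conj[l1 _] [_ hl]].
  by exists l.2.
split=> //.
have Ds0 : forall z, `|z| <= 1 -> (rden h.1).[z] != 0.
  apply: (@bounded_no_pole _ h.1 2) => z /hG/Gamma_bounds[/= + _].
  by rewrite normcR -[2](rmorph_nat (real_complex R)) lecR.
have sD : (size D <= m.+1)%N by have [_ []] := leq_size_rdegree h.2.
have [|E [EE sE Er]] :=
  @conj_quotient_refl _ m c N D _ _ (coprimep_rnum_rden h.1) Ds0 D0 sD c1 NE.
  apply: ae_circle_conj_eq; apply: ae_impl ae => t [l /bGamma_conj[_ lc] [l1 l2]].
  have z1 : `|expi t| <= 1 :> C by rewrite norm_expi.
  move: lc; rewrite (radial_limit_unique (Ds0 _ z1) l1).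
  rewrite (radial_limit_unique (D0 _ z1) l2) /reval -/N -/D => lc /=.
  have a0 := Ds0 _ z1; have b0 := D0 _ z1; have a1 : ((rden h.1).[expi t])^* != 0.
    by rewrite conjC_eq0.
  move: lc; rewrite rmorphM /= fmorphV /=.
  move: a1 a0 b0; move: (_^*) => x; move: (_.[_]^*) => y.
  move: ((rden h.1).[_]) ((rnum h.1).[_]) (D.[_]) (N.[_]) => u v w r x0 u0 w0 e.
  apply: (mulfI (invr_neq0 u0)).
  have -> : u^-1 * (v * w * x) = (v / u) * w * x by ring.
  by rewrite e; field; rewrite x0 u0 w0.
exists c, E; split=> //; split=> [|z z1].
  rewrite [LHS]ratfunE; apply/eqP; rewrite eqr_div ?tofrac_eq0 ?rden_neq0 //.
  by rewrite -!tofracM tofrac_eq -/D EE.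
apply/eqP; rewrite /reval eqr_div ?D0 ?Ds0 //.
have := congr1 (fun p : {poly C} => p.[z]) EE; rewrite !hornerM => ->.
by rewrite mulrC.
Qed.
End Boundary.

(** * Winding numbers *)

Lemma continuous_comp_within (X Y Z : topologicalType) (A : set Y) (H : Y -> Z)
    (g : X -> Y) :
  {within A, continuous H} -> continuous g -> (forall x, A (g x)) ->
  continuous (H \o g).
Proof.
move=> /subspace_continuousP cH cg Ag x P /(cH _ (Ag x)) hP.
apply: (@filterS _ (nbhs x) _ (fun y => A (g y) -> P (H (g y)))).
  by move=> y; apply; exact: Ag.
exact: (cg x _ hP).
Qed.

Section Winding.
Variable R : realType.
Local Notation C := R[i].
Local Notation normc := (@Normc.normc R).
Implicit Types (q : C -> C) (z w : C) (x t : R).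

(** Functions on the circle of winding number zero: those with a continuous,
    hence single-valued, argument. *)
Definition has_lift q := exists a : R -> R,
  [/\ continuous a, (forall x, a (x + pi *+ 2) = a x) &
    forall x, q (expi x) = expi (a x)].

Lemma cvg_fst_comp (S : topologicalType) (u : R -> S) (p : R * R) :
  continuous u -> (fun p : R * R => u p.1) @ p --> u p.1.
Proof.
by move=> cu; apply: (@continuous_comp _ _ _ fst u); [exact: cvg_fst|exact: cu].
Qed.

Lemma cvg_snd_comp (S : topologicalType) (u : R -> S) (p : R * R) :
  continuous u -> (fun p : R * R => u p.2) @ p --> u p.2.
Proof.
by move=> cu; apply: (@continuous_comp _ _ _ snd u); [exact: cvg_snd|exact: cu].
Qed.

Lemma has_liftM q r : has_lift q -> has_lift r -> has_lift (fun z => q z * r z).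
Proof.
move=> [a [ca pa qa]] [b [cb pb rb]]; exists (fun x => a x + b x); split.
- by move=> x; apply: cvgD; [exact: ca|exact: cb].
- by move=> x; rewrite pa pb.
- by move=> x; rewrite qa rb expiD.
Qed.

Lemma has_lift_conj q : has_lift q -> has_lift (fun z => (q z)^*).
Proof.
move=> [a [ca pa qa]]; exists (fun x => - a x); split.
- by move=> x; apply: cvgN; exact: ca.
- by move=> x; rewrite pa.
- by move=> x; rewrite qa expiN.
Qed.

Lemma has_lift_ext q r : (forall z, `|z| = 1 -> q z = r z) ->
  has_lift q -> has_lift r.
Proof.
move=> qr [a [ca pa qa]]; exists a; split=> // x.
by rewrite -qr ?qa // norm_expi.
Qed.

Lemma expiD2pi x : expi (x + pi *+ 2) = expi x :> C.
Proof. by rewrite expiD expi_2pi mulr1. Qed.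

(** The argument is the arcsine of the imaginary part. *)
Lemma has_lift_right_half_plane q : continuous (fun x => q (expi x)) ->
  (forall z, `|z| = 1 -> `|q z| = 1) ->
  (forall z, `|z| = 1 -> 0 < complex.Re (q z)) -> has_lift q.
Proof.
move=> cq q1 q0; exists (fun x => asin (complex.Im (q (expi x)))).
have e1 x : complex.Re (q (expi x)) ^+ 2 + complex.Im (q (expi x)) ^+ 2 = 1.
  by rewrite -normc_sqr ((normc1P _).1 (q1 _ (norm_expi x))) expr1n.
have I1 x : -1 < complex.Im (q (expi x)) < 1.
  rewrite -ltr_norml -(@ltr_pXn2r _ 2) ?nnegrE ?normr_ge0 ?ler01 //.
  rewrite real_normK ?num_real // expr1n -(e1 x) ltrDr exprn_gt0 //.
  by rewrite q0 // norm_expi.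
split=> x.
- apply: (@continuous_comp _ _ _ (fun x => complex.Im (q (expi x)))).
    exact: cvg_Im (cq x).
  exact: continuous_asin.
- by rewrite expiD2pi.
- have /andP[l u] := I1 x; have q0x := q0 _ (norm_expi x).
  rewrite /expi asinK ?in_itv /= ?ltW // cos_asin ?ltW ?l ?u //.
  rewrite -(e1 x) addrK sqrtr_sqr gtr0_norm //.
  by case: (q _).
Qed.

Lemma Re_mul_conj_gt0 z w : `|z| = 1 -> `|w| = 1 -> normc (z - w) < 1 ->
  0 < complex.Re (z * w^*).
Proof.
move=> /normc1P z1 /normc1P w1 zw.
have : normc (z - w) ^+ 2 < 1 by rewrite expr_lt1 // normc_ge0.
have := congr1 (fun x => x ^+ 2) z1; have := congr1 (fun x => x ^+ 2) w1.
rewrite !normc_sqr !expr1n; case: z {z1 zw} => a b; case: w {w1} => c d /=.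
by rewrite mulrN opprK; nra.
Qed.

(** Two unimodular functions at distance less than 1 differ by a factor in the right
    half-plane, which has a lift. By compactness of the interval of angles, the set of
    t for which k s and k t differ by a factor with a lift is thus open and closed. *)
Lemma homotopy_has_lift (k : R -> C -> C) :
  continuous (fun p : R * R => k p.1 (expi p.2)) ->
  (forall t z, `|z| = 1 -> `|k t z| = 1) ->
  forall s t, has_lift (fun z => k s z * (k t z)^*).
Proof.
move=> ck k1 s.
have kc (T : Type) (F : set_system T) (FF : Filter F) (u v : T -> R) (a b : R) :
    u @ F --> a -> v @ F --> b -> (fun i => k (u i) (expi (v i))) @ F --> k a (expi b).
  by move=> ua vb; apply: (cvg_comp _ _ (cvg_pair ua vb) (ck (a, b))).
(* The classes are open, by compactness of the interval of angles. *)
have near_lift t : \forall t' \near t, has_lift (fun z => k t z * (k t' z)^*).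
  have : \forall t' \near t, `[- pi, pi]%classic `<=`
      (fun x => normc (k t (expi x) - k t' (expi x)) < 1).
    have /compact_near_coveringP nc := @segment_compact R (- pi) pi.
    apply: (nc _ (nbhs t) (fun t' x => normc (k t (expi x) - k t' (expi x)) < 1)).
    move=> x _.
    have c : (fun p : R * R => normc (k t (expi p.1) - k p.2 (expi p.1))) @ (x, t)
        --> normc (k t (expi x) - k t (expi x)).
      apply: cvg_normc; apply: cvgB; apply: kc; try exact: cvg_fst.
        exact: cvg_cst.
      exact: cvg_snd.
    by move: c; rewrite subrr Normc.normc0 => /cvgr_lt/(_ 1 ltr01).
  apply: filterS => t' h; apply: has_lift_right_half_plane => [x|z z1|z z1].
  - have ct r : (fun y => k r (expi y)) @ x --> k r (expi x).
      by apply: kc; [exact: cvg_cst|exact: cvg_id].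
    apply: cvgM; first exact: ct.
    exact: cvg_conjC (ct t').
  - by rewrite normrM norm_conjC !k1 // mulr1.
  - have [x xpi ->] := expi_surj z1.
    by apply: Re_mul_conj_gt0; rewrite ?k1 ?norm_expi //; apply: h; rewrite /= in_itv.
pose A := [set t | has_lift (fun z => k s z * (k t z)^*)].
have trans t t' : has_lift (fun z => k t z * (k t' z)^*) ->
    has_lift (fun z => k s z * (k t z)^*) <-> has_lift (fun z => k s z * (k t' z)^*).
  move=> tt'; split=> h.
    apply: has_lift_ext (has_liftM h tt') => z z1; have := circle_mulC (k1 t z z1).
    by move=> e; rewrite mulrA -(mulrA (k s z)) [_^* * k t z]mulrC e mulr1.
  apply: has_lift_ext (has_liftM h (has_lift_conj tt')) => z z1.
  rewrite rmorphM /= conjCK; have e := circle_mulC (k1 t' z z1).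
  by rewrite -mulrA [_^* * (_ * _)]mulrCA [_^* * k t' z]mulrC e mulr1.
suff AT : A = setT by move=> t; have : A t by rewrite AT.
have /connected_intervalP cT : is_interval [set: R] by [].
apply: cT.
- exists s; rewrite /A /=; apply: has_lift_ext (nbhs_singleton (near_lift s)).
  by [].
- exists A; last by rewrite setTI.
  rewrite openE => t At; apply: filterS (near_lift t) => t' tt'.
  exact: (trans _ _ tt').1.
- exists A; last by rewrite setTI.
  rewrite -[A]setCK; apply: open_closedC; rewrite openE => t At.
  apply: filterS (near_lift t) => t' tt' /(trans _ _ tt').2 //.
Qed.

(** The lift and the affine function (m - n) x + c0 differ by a continuous function
    with values in the multiples of 2 pi. It is constant, so the affine function
    is 2 pi-periodic. *)
Lemma has_lift_pow_unique c m n : `|c| = 1 ->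
  has_lift (fun z => c * z ^+ m * (z ^+ n)^*) -> m = n.
Proof.
move=> c1 [a [ca pa qa]]; have [c0 _ cE] := expi_surj c1.
pose b x := a x - ((m%:R - n%:R) * x + c0).
have eb x : expi (b x) = 1 :> C.
  rewrite /b expiD -qa expiN expiD -cE mulrBl expiD expiN !expiMn.
  set z := expi x; have zn : z ^+ n != 0.
    by rewrite expf_neq0 // circle_neq0 // norm_expi.
  rewrite !rmorphM /= conjCK -[RHS](circle_mulC (z := c * z ^+ m * z ^+ n)); last first.
    by rewrite !normrM !normrX norm_expi !expr1n c1 !mulr1.
  rewrite !rmorphM /=; ring.
have cb : continuous b.
  move=> x; apply: cvgB; first exact: ca.
  by apply: cvgD; [apply: cvgM; [exact: cvg_cst|exact: cvg_id]|exact: cvg_cst].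
have pi0 := pi_gt0 R.
have bE : b (pi *+ 2) = b 0.
  apply/eqP/negPn/negP => bne.
  set lo := Num.min (b 0) (b (pi *+ 2)); set hi := Num.max (b 0) (b (pi *+ 2)).
  have lohi : lo < hi.
    have [h|h|h] := ltgtP (b 0) (b (pi *+ 2)).
    - by rewrite /lo /hi (min_l (ltW h)) (max_r (ltW h)).
    - by rewrite /lo /hi (min_r (ltW h)) (max_l (ltW h)).
    - by rewrite h eqxx in bne.
  have img v : lo <= v <= hi -> expi v = 1 :> C.
    move=> vI; have [] := @IVT R b 0 (pi *+ 2) v _ _ vI.
    - by rewrite mulrn_wge0 // ltW.
    - exact: continuous_subspaceT.
    - by move=> x _ <-.
  (* By the intermediate value theorem expi would be 1 on all of [lo, hi],
     but expi is injective on [0, 1]. *)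
  pose d := Num.min (hi - lo) 1.
  have d0 : 0 < d by rewrite lt_min subr_gt0 lohi ltr01.
  have d1 : d <= 1 by rewrite ge_min lexx orbT.
  have dh : d <= hi - lo by rewrite ge_min lexx.
  have : expi d = expi 0 :> C.
    have -> : d = (lo + d) + - lo by rewrite addrC addKr.
    have i1 : lo <= lo + d <= hi by rewrite lerDl (ltW d0) -lerBrDl.
    have i2 : lo <= lo <= hi by rewrite lexx ltW.
    by rewrite expiD expiN expi0 (img _ i1) (img _ i2) conjC1 mulr1.
  move=> /expi_inj01 e; have := e; rewrite (ltW d0) d1 lexx ler01 => /(_ isT isT).
  by move=> d00; rewrite d00 ltxx in d0.
move: bE; rewrite /b -{1}[pi *+ 2]add0r pa mulr0 add0r.
move/addrI/oppr_inj/eqP; rewrite -subr_eq0 addrK mulf_eq0 mulrn_eq0 /=.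
by rewrite (gt_eqF pi0) orbF subr_eq0 eqr_nat => /eqP.
Qed.

(** Shrinking the argument of D to 0 deforms the quotient c z^m conj(D) / D to a
    constant times z^m through unimodular functions, because D has no zero in the
    disc. The homotopy H deforms the same quotient to z^n. *)
Lemma winding_refl_quotient (D : {poly C}) c m n (H : R * C -> C) (f : C -> C) :
  (forall z, `|z| <= 1 -> D.[z] != 0) -> `|c| = 1 ->
  (forall z, `|z| = 1 -> f z = c * z ^+ m * ((D.[z])^* / D.[z])) ->
  {within `[0, 1] `*` @circle R, continuous H} ->
  (forall t z, 0 <= t <= 1 -> `|z| = 1 -> `|H (t, z)| = 1) ->
  (forall z, `|z| = 1 -> H (0, z) = f z) ->
  (forall z, `|z| = 1 -> H (1, z) = z ^+ n) -> m = n.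
Proof.
move=> D0 c1 fE cH H1 H0f H1n.
(* A surjection of the line onto [0, 1], from 0 at t = 0 to 1 at t = pi / 2. *)
pose sq t : R := sin t * sin t.
have sq0 : sq 0 = 0 by rewrite /sq sin0 mul0r.
have sq1 : sq (pi / 2) = 1 by rewrite /sq sin_pihalf mulr1.
have sq01 t : 0 <= sq t <= 1.
  by have := sin_le1 t; have := sin_geN1 t; rewrite /sq; nra.
have csq : continuous sq.
  by move=> t; apply: cvgM; exact: continuous_sin.
have l1 : has_lift (fun z => f z * (z ^+ n)^*).
  apply: has_lift_ext (@homotopy_has_lift (fun t z => H (sq t, z)) _ _ 0 (pi / 2)).
  - by move=> z z1; rewrite sq0 sq1 H0f // H1n.
  - apply: (@continuous_comp_within _ _ _ _ H
      (fun p : R * R => (sq p.1, expi p.2)) cH) => [[t x]|[t x]].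
      exact: (cvg_pair (@cvg_fst_comp _ sq (t, x) csq)
        (@cvg_snd_comp _ (@expi R) (t, x) (@continuous_expi R))).
    by split=> /=; [rewrite in_itv /=; exact: sq01|exact: norm_expi].
  - by move=> t z; apply: H1.
have D0' t z : `|z| = 1 -> D.[(sq t)%:C%C * z] != 0.
  move=> z1; apply: D0; rewrite normrM z1 mulr1 normcR lecR normc_real.
  by have /andP[a b] := sq01 t; rewrite ger0_norm.
have l2 : has_lift (fun z => (f z)^* * (c * z ^+ m * ((D.[0])^* / D.[0]))).
  pose k t z : C := ((c * z ^+ m) * ((D.[(sq t)%:C%C * z])^* / D.[(sq t)%:C%C * z]))^*.
  have u : `|(D.[0])^* / D.[0]| = 1.
    by rewrite normf_div norm_conjC divff // normr_eq0 D0 // normr0 ler01.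
  apply: has_lift_ext (@homotopy_has_lift k _ _ (pi / 2) 0).
  - by move=> z z1; rewrite /k sq0 sq1 !mul0r mul1r conjCK fE.
  - move=> [t x]; rewrite /k; apply: cvg_conjC.
    have cD : (fun p : R * R => D.[(sq p.1)%:C%C * expi p.2]) @ (t, x) -->
        D.[(sq t)%:C%C * expi x].
      apply: (@cvg_comp _ _ _ (fun p : R * R => (sq p.1)%:C%C * expi p.2)
        (horner D) _ _ _ _ (@continuous_hornerC R D _)).
      apply: cvgM; last exact: cvg_snd_comp (@continuous_expi R).
      apply: (@cvg_fst_comp _ (fun r => (sq r)%:C%C) (t, x)) => r.
      exact: (cvg_comp _ _ (csq r) (@cvg_real_complex R _)).
    apply: cvgM; last first.
      apply: cvgM; first exact: cvg_conjC.
      by apply: cvgV => //; apply: D0'; exact: norm_expi.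
    apply: (@cvg_snd_comp _ (fun r => c * expi r ^+ m) (t, x)) => r.
    rewrite (_ : (fun r => _) = (fun r => (c%:P * 'X^m).[expi r])); last first.
      by apply/funext => r'; rewrite !hornerE.
    exact: (cvg_comp _ _ (@continuous_expi R r) (@continuous_hornerC R _ _)).
  - move=> t z z1; rewrite /k norm_conjC normrM normf_div norm_conjC divff ?normr_eq0 ?D0' //.
    by rewrite mulr1 normrM normrX z1 c1 expr1n mulr1.
have f1 z : `|z| = 1 -> `|f z| = 1.
  by move=> z1; rewrite -H0f // H1 // lexx ler01.
have u : `|(D.[0])^* / D.[0]| = 1.
  by rewrite normf_div norm_conjC divff // normr_eq0 D0 // normr0 ler01.
apply: (@has_lift_pow_unique (c * ((D.[0])^* / D.[0]))).
  by rewrite normrM c1 u mulr1.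
apply: has_lift_ext (has_liftM l1 l2) => z z1.
have := circle_mulC (f1 z z1); set w := (f z)^* => e.
ring: e.
Qed.
End Winding.

(** * Phasar derivatives *)

Section Phasar.
Variable R : realType.
Local Notation C := R[i].
Local Notation normc := (@Normc.normc R).
Local Notation Re := (@complex.Re R).
Local Notation Im := (@complex.Im R).
Implicit Types (f g : R -> C) (z d e : C) (F G N M : {poly C}) (t x : R).

(** The complex numbers are normed over themselves and not over the reals; the
    derivative of a path in the plane is therefore taken componentwise. *)
Definition has_cderive f t d :=
  is_derive t (1 : R) (fun x => Re (f x)) (Re d) /\
  is_derive t (1 : R) (fun x => Im (f x)) (Im d).

Lemma cderive_unique f t d e : has_cderive f t d -> has_cderive f t e -> d = e.
Proof.
move=> [[_ d1] [_ d2]] [[_ e1] [_ e2]]; apply/eqP; rewrite eq_complex.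
by rewrite -d1 -d2 -e1 -e2 !eqxx.
Qed.

Lemma cderive_near f g t d : (\forall x \near t, f x = g x) ->
  has_cderive f t d -> has_cderive g t d.
Proof.
move=> fg [d1 d2]; split.
  by apply: near_eq_is_derive d1; apply: filterS fg => x ->.
by apply: near_eq_is_derive d2; apply: filterS fg => x ->.
Qed.

Lemma cderive_cst z t : has_cderive (fun=> z) t 0.
Proof. by split; exact: is_derive_cst. Qed.

Lemma cderiveD f g t d e : has_cderive f t d -> has_cderive g t e ->
  has_cderive (fun x => f x + g x) t (d + e).
Proof.
move=> [f1 f2] [g1 g2]; split.
  rewrite (_ : (fun x => Re (f x + g x)) = (fun x => Re (f x)) + (fun x => Re (g x))).
    by rewrite raddfD; exact: is_deriveD.
  by apply/funext => x; rewrite raddfD.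
rewrite (_ : (fun x => Im (f x + g x)) = (fun x => Im (f x)) + (fun x => Im (g x))).
  by rewrite raddfD; exact: is_deriveD.
by apply/funext => x; rewrite raddfD.
Qed.

Lemma ReD z e : Re (z + e) = Re z + Re e.
Proof. by case: z => a b; case: e. Qed.

Lemma ImD z e : Im (z + e) = Im z + Im e.
Proof. by case: z => a b; case: e. Qed.

Lemma ReM z e : Re (z * e) = Re z * Re e - Im z * Im e.
Proof. by case: z => a b; case: e. Qed.

Lemma ImM z e : Im (z * e) = Re z * Im e + Im z * Re e.
Proof. by case: z => a b; case: e. Qed.

Lemma cderiveM f g t d e : has_cderive f t d -> has_cderive g t e ->
  has_cderive (fun x => f x * g x) t (d * g t + f t * e).
Proof.
move=> [f1 f2] [g1 g2]; split.
  rewrite (_ : (fun x => Re (f x * g x)) =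
    (fun x => Re (f x)) * (fun x => Re (g x)) - (fun x => Im (f x)) * (fun x => Im (g x))).
    apply: (is_derive_eq (is_deriveB (is_deriveM f1 g1) (is_deriveM f2 g2))).
    by rewrite ReD !ReM /GRing.scale /=; ring.
  by apply/funext => x; rewrite ReM.
rewrite (_ : (fun x => Im (f x * g x)) =
    (fun x => Re (f x)) * (fun x => Im (g x)) + (fun x => Im (f x)) * (fun x => Re (g x))).
  apply: (is_derive_eq (is_deriveD (is_deriveM f1 g2) (is_deriveM f2 g1))).
  by rewrite ImD !ImM /GRing.scale /=; ring.
by apply/funext => x; rewrite ImM.
Qed.

Lemma cderive_expi (u : R -> R) t a : is_derive t (1 : R) u a ->
  has_cderive (fun x => expi (u x)) t ('i%C * a%:C%C * expi (u t)).
Proof.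
move=> ua; split=> /=.
  apply: (is_derive_eq (is_derive1_comp (is_derive_cos (u t)) ua)); ring.
apply: (is_derive_eq (is_derive1_comp (is_derive_sin (u t)) ua)); ring.
Qed.

Lemma cderive_horner F t :
  has_cderive (fun x => F.[expi x]) t ('i%C * expi t * F^`().[expi t]).
Proof.
elim/poly_ind: F => [|F c IH].
  rewrite deriv0 horner0 mulr0 (_ : (fun x => _) = (fun=> 0)).
    exact: cderive_cst.
  by apply/funext => x; rewrite horner0.
rewrite (_ : (fun x => _) = (fun x => F.[expi x] * expi x + c)); last first.
  by apply/funext => x; rewrite hornerMXaddC.
have := cderiveD (cderiveM IH (cderive_expi (is_derive_id t 1))) (cderive_cst c t).
congr has_cderive; rewrite derivD derivM derivX derivC mulr1.
by rewrite !hornerD hornerM hornerX horner0 rmorph1; ring.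
Qed.

Lemma cderive_real (k : R -> R) t a : is_derive t (1 : R) k a ->
  has_cderive (fun x => (k x)%:C%C) t a%:C%C.
Proof. by move=> ka; split=> //=; exact: is_derive_cst. Qed.

Lemma derivable_normc2 f t d : has_cderive f t d ->
  derivable (fun x => normc (f x) ^+ 2) t 1.
Proof.
move=> [[d1 _] [d2 _]].
rewrite (_ : (fun x => _) = (fun x => Re (f x)) ^+ 2 + (fun x => Im (f x)) ^+ 2).
  by apply: derivableD; [move: d1|move: d2] => h; exact: derivableX.
by apply/funext => x; rewrite normc_sqr.
Qed.

Lemma derivable_scaleB (a : R) (u v : R -> R) t :
  derivable u t 1 -> derivable v t 1 -> derivable (fun x => a * u x - v x) t 1.
Proof.
move=> du dv; have -> : (fun x => a * u x - v x) = a *: u - v by [].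
by apply: derivableB dv; exact: derivableZ.
Qed.

(** Along the circle F is G times a nonnegative real function with a zero at t;
    this zero is a minimum, so it is at least double, and F inherits it. *)
Lemma deriv_eq0_at_min F G (k : R -> R) t :
  (forall x, F.[expi x] = G.[expi x] * (k x)%:C%C) -> (forall x, 0 <= k x) ->
  (forall x, derivable k x 1) -> k t = 0 -> F^`().[expi t] = 0.
Proof.
move=> FG k0 dk kt.
have k't : is_derive t (1 : R) k 0.
  apply: (@derive1_at_min _ k (t - 1) (t + 1)) => //; first by lra.
    by rewrite in_itv /=; lra.
  by move=> x _; rewrite kt.
have := cderiveM (cderive_horner G t) (cderive_real k't).
rewrite -(funext FG) kt rmorph0 !mulr0 addr0 => /cderive_unique.
move=> /(_ _ (cderive_horner F t))/esym/eqP; rewrite !mulf_eq0.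
rewrite (negbTE (circle_neq0 (norm_expi t))) orbF => /orP[|/eqP//].
by rewrite eq_complex /= oner_eq0 andbF.
Qed.

Lemma complex_invE z :
  z^-1 = (Re z * (normc z ^+ 2)^-1 +i* (- Im z * (normc z ^+ 2)^-1))%C.
Proof. by rewrite normc_sqr; case: z => a b; rewrite /= mulNr. Qed.

(** Only the existence of the derivative is computed in coordinates; its value comes
    from differentiating f f^-1 = 1. *)
Lemma cderiveV f t d : (forall x, f x != 0) -> has_cderive f t d ->
  has_cderive (fun x => (f x)^-1) t (- d / (f t) ^+ 2).
Proof.
move=> f0 fd; have [[f1 _] [f2 _]] := fd.
have n0 : normc (f t) ^+ 2 != 0.
  by rewrite sqrf_eq0; apply: contra_neq (f0 t) => /Normc.eq0_normc.
have dn : derivable (fun x => (normc (f x) ^+ 2)^-1) t 1.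
  exact: (@derivableV _ _ (fun x => normc (f x) ^+ 2) _ _ n0 (derivable_normc2 fd)).
pose k x := (normc (f x) ^+ 2)^-1.
have [e fe] : exists e, has_cderive (fun x => (f x)^-1) t e.
  exists ('D_1 (fun x => Re (f x) * k x) t +i* 'D_1 (fun x => - Im (f x) * k x) t)%C.
  split=> /=.
    rewrite (_ : (fun x => _) = (fun x => Re (f x) * k x)); last first.
      by apply/funext => x; rewrite complex_invE.
    apply: derivableP.
    exact: (@derivableM _ _ (fun x => Re (f x)) k t 1 f1 dn).
  rewrite (_ : (fun x => _) = (fun x => - Im (f x) * k x)); last first.
    by apply/funext => x; rewrite complex_invE.
  apply: derivableP.
  exact: (@derivableM _ _ (fun x => - Im (f x)) k t 1 (derivableN f2) dn).
have := cderiveM fd fe; rewrite (_ : (fun x => _) = (fun=> 1)); last first.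
  by apply/funext => x; rewrite divff.
move=> /cderive_unique/(_ (cderive_cst 1 t)) E.
rewrite (_ : - d / _ = e) //; apply: (mulfI (f0 t)).
have -> : f t * e = - (d / f t) by move/eqP: E; rewrite addr_eq0 -eqr_oppLR => /eqP.
by field.
Qed.

(** The identity A f = z f' / f for f = N / M, cleared of denominators. From left to
    right, differentiate N = e^{iu} M along the circle. From right to left, near z the
    quotient f / f(z) is in the right half-plane, so that u = arg f(z) + asin(Im(f / f(z)))
    is a branch of the argument. *)
Lemma phasar_polyP (f : C -> C) N M z a :
  (forall z, `|z| = 1 -> f z = N.[z] / M.[z]) ->
  (forall z, `|z| = 1 -> M.[z] != 0) ->
  (forall z, `|z| = 1 -> `|N.[z]| = `|M.[z]|) -> `|z| = 1 ->
  is_phasar_derivative f z a <->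
  z * (N^`().[z] * M.[z] - N.[z] * M^`().[z]) = a%:C%C * N.[z] * M.[z].
Proof.
move=> fE M0 NM z1.
have f1 w : `|w| = 1 -> `|f w| = 1.
  by move=> w1; rewrite fE // normf_div NM // divff // normr_eq0 M0.
have i0 : 'i%C != 0 :> C by rewrite eq_complex /= oner_eq0 andbF.
split=> [[t [u [zE fu ua]]]|eqa].
  have NuM : \forall x \near t, expi (u x) * M.[expi x] = N.[expi x].
    apply: filterS fu => x [_]; rewrite f1 ?norm_expi // mul1r => <-.
    by rewrite fE ?norm_expi // mulfVK // M0 // norm_expi.
  have /(cderive_near NuM) := cderiveM (cderive_expi ua) (cderive_horner M t).
  move=> /cderive_unique/(_ (cderive_horner N t)).
  move/nbhs_singleton: NuM; rewrite -zE => NE E.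
  apply: (mulfI i0).
  have -> : 'i%C * (z * (N^`().[z] * M.[z] - N.[z] * M^`().[z])) =
    ('i%C * z * N^`().[z]) * M.[z] - 'i%C * z * N.[z] * M^`().[z] by ring.
  by rewrite -E -NE; ring.
have [t _ zE] := expi_surj z1.
have [u0 _ fz] := expi_surj (f1 z z1).
have fz0 : f z != 0 by rewrite -normr_eq0 f1 // oner_eq0.
pose m x := M.[expi x]; pose g x := N.[expi x] * (m x)^-1 * (f z)^-1.
have m0 x : m x != 0 by rewrite M0 // norm_expi.
have gE x : f (expi x) = f z * g x.
  by rewrite /g fE ?norm_expi // mulrCA divff ?mulr1.
have gt : g t = 1 by apply: (mulfI fz0); rewrite -gE -zE mulr1.
have [e ge] : exists e, has_cderive g t e.
  eexists; apply: cderiveM; last exact: cderive_cst.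
  by apply: cderiveM; [exact: cderive_horner|apply: cderiveV; [|exact: cderive_horner]].
have eE : e = ('i * a%:C)%C.
  have N0 : N.[z] != 0 by rewrite -normr_eq0 NM // normr_eq0 M0.
  have Mz := M0 _ z1.
  have := cderiveM (cderiveM ge (cderive_horner M t)) (cderive_cst (f z) t).
  rewrite (_ : (fun x => _) = (fun x => N.[expi x])); last first.
    by apply/funext => x; rewrite /g -/(m x); field; rewrite fz0 m0.
  move=> /cderive_unique/(_ (cderive_horner N t)); rewrite gt -zE mulr0 addr0 mul1r.
  rewrite fE // => E; apply: (mulIf N0); apply: (mulIf Mz).
  have -> : e * N.[z] * M.[z] =
      M.[z] * ((e * M.[z] + 'i%C * z * M^`().[z]) * (N.[z] / M.[z])) -
      'i%C * z * M^`().[z] * N.[z] by field.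
  rewrite E; have -> : ('i * a%:C)%C * N.[z] * M.[z] = 'i%C * (a%:C%C * N.[z] * M.[z]).
    by rewrite !mulrA.
  by rewrite -eqa; ring.
have g1 x : normc (g x) = 1.
  have := f1 _ (norm_expi x); rewrite gE normrM f1 // mul1r => /normc1P //.
exists t, (fun x => u0 + asin (Im (g x))); split=> //.
  have /cvgr_gt/(_ 0) : (fun x => Re (g x)) @ t --> Re (g t).
    have [[dg _] _] := ge.
    exact: (differentiable_continuous ((derivable1_diffP _ _).1 dg)).
  rewrite gt ltr01 => /(_ isT); apply: filterS => x gx0.
  rewrite f1 ?norm_expi // mul1r; split; first by rewrite -normr_eq0 f1 ?norm_expi ?oner_eq0.
  rewrite expiD -fz gE; congr (_ * _).
  have e1 : Re (g x) ^+ 2 + Im (g x) ^+ 2 = 1 by rewrite -normc_sqr g1 expr1n.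
  have I1 : -1 <= Im (g x) <= 1.
    by rewrite -ler_norml (le_trans (norm_Im_le _)) // g1.
  rewrite /expi asinK ?in_itv //= cos_asin // -e1 addrK sqrtr_sqr gtr0_norm //.
  by case: (g x).
have [_ dI] := ge.
have Igt : Im (g t) = 0 by rewrite gt.
have := @is_derive1_asin R (Im (g t)); rewrite Igt ltrN10 ltr01 => /(_ isT) das.
rewrite -Igt in das.
have dc := is_derive1_comp das dI.
apply: (is_derive_eq (is_deriveD (is_derive_cst u0 t 1) dc)).
by rewrite add0r Igt eE ImM expr0n /= subr0 sqrtr1 invr1 !mul1r mul0r add0r.
Qed.
End Phasar.

(** * The royal polynomial and the numerator and denominator of Phi_omega o h *)

Section RoyalPolynomial.
Variable C : numClosedFieldType.
Implicit Types (D E F G M N P Q : {poly C}) (z s c omega eta rho : C) (n : nat).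

(** D^2 (4 p - s^2) for s = E / D and p = N / D; the royal variety is s^2 = 4 p. *)
Definition royal_poly D N E := 4 *: (D * N) - E ^+ 2.
Definition phi_num omega N E := (2 * omega) *: N - E.
Definition phi_den omega D E := 2 *: D - omega *: E.

Lemma size_mul_leq2n n F G : (size F <= n.+1)%N -> (size G <= n.+1)%N ->
  (size (F * G)%R <= (2 * n).+1)%N.
Proof.
move=> sF sG; apply: leq_trans (size_polyMleq _ _) _.
apply: (leq_trans (n := (n.+1 + n.+1).-1)); last by lia.
by rewrite -!subn1 leq_sub2r // leq_add.
Qed.

Lemma horner_royal D N E z :
  (royal_poly D N E).[z] = 4 * D.[z] * N.[z] - E.[z] ^+ 2.
Proof. by rewrite !hornerE. Qed.

Lemma horner_phi_num omega N E z :
  (phi_num omega N E).[z] = 2 * omega * N.[z] - E.[z].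
Proof. by rewrite !hornerE. Qed.

Lemma horner_phi_den omega D E z :
  (phi_den omega D E).[z] = 2 * D.[z] - omega * E.[z].
Proof. by rewrite !hornerE. Qed.

(** A self-reflective polynomial that vanishes at the given nodes, doubly at
    those on the circle, is a constant times the product of the node factors as soon as
    its formal degree is twice the number of nodes; it has then no other zero in the
    closed disc. *)
Lemma reflective_root_mem (l : seq C) F u z : uniq l ->
  (size F <= (2 * size l).+1)%N -> refl (2 * size l) F = u *: F ->
  (forall s, s \in l -> [/\ F.[s] = 0, `|s| <= 1 & `|s| = 1 -> F^`().[s] = 0]) ->
  F != 0 -> `|z| <= 1 -> F.[z] = 0 -> z \in l.
Proof.
move=> ul sF rF hl F0 z1 Fz.
have [|||F1 FE sF1] := @roots_factor_refl _ 0 l F u ul; rewrite ?addn0 //.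
have F1E := size1_polyC sF1.
have F10 : F1`_0 != 0.
  by apply: contraNneq F0 => e; rewrite FE F1E e mulr0.
have : \prod_(s <- l) (node_factor s).[z] == 0.
  move: Fz; rewrite FE F1E hornerM hornerC horner_prod => /eqP.
  by rewrite mulf_eq0 (negbTE F10) orbF.
rewrite prodf_seq_eq0 => /hasP[s sl /= /eqP e].
by have [_ s1 _] := hl s sl; rewrite (node_factor_root s1 z1 e).
Qed.

Lemma exists_circle_notin (l : seq C) : exists2 z, `|z| = 1 & z \notin l.
Proof.
apply: contrapT => h.
have /eqP : \prod_(s <- l) ('X - s%:P) = 0 :> {poly C}.
  apply: poly_eq_circle => z z1; rewrite horner0; apply/eqP.
  rewrite -rootE root_prod_XsubC; apply/negPn/negP => zl.
  by apply: h; exists z.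
by apply/negP; rewrite monic_neq0 // monic_prod_XsubC.
Qed.

Section Symmetric.
Variables (n : nat) (c : C) (D N E : {poly C}).
Hypotheses (c1 : `|c| = 1) (sD : (size D <= n.+1)%N) (sE : (size E <= n.+1)%N).
Hypotheses (NE : N = c *: refl n D) (EE : E = c *: refl n E).

Lemma N_circle z : `|z| = 1 -> N.[z] = c * z ^+ n * (D.[z])^*.
Proof. by move=> z1; rewrite NE hornerZ horner_refl_circle // mulrA. Qed.

Lemma E_circle z : `|z| = 1 -> E.[z] = c * z ^+ n * (E.[z])^*.
Proof. by move=> z1; rewrite {1}EE hornerZ horner_refl_circle // mulrA. Qed.

Lemma size_N : (size N <= n.+1)%N.
Proof. by rewrite NE (leq_trans (size_scale_leq _ _)) // size_refl. Qed.

Lemma royal_circle z : `|z| = 1 ->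
  (royal_poly D N E).[z] = c * z ^+ n * (4 * `|D.[z]| ^+ 2 - `|E.[z]| ^+ 2).
Proof.
move=> z1; rewrite horner_royal !normCK expr2 {1}(E_circle z1) (N_circle z1).
by move: (D.[z]^*) (E.[z]^*) => x y; ring.
Qed.

Lemma size_royal : (size (royal_poly D N E) <= (2 * n).+1)%N.
Proof.
rewrite (leq_trans (size_polyD _ _)) // geq_max size_polyN; apply/andP; split.
  by rewrite (leq_trans (size_scale_leq _ _)) // size_mul_leq2n // size_N.
by rewrite expr2 size_mul_leq2n.
Qed.

Lemma refl_royal : refl (2 * n) (royal_poly D N E) = (c^* ^+ 2) *: royal_poly D N E.
Proof.
apply: poly_eq_circle => z z1; rewrite hornerZ horner_refl_circle ?size_royal //.
rewrite !horner_royal mul2n -addnn exprD.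
have cc := circle_mulC c1; have zz := circle_mulC z1.
have zn : z ^+ n * (z^*) ^+ n = 1 by rewrite -exprMn zz expr1n.
rewrite rmorphB !rmorphM /= conjC_nat [in RHS](E_circle z1).
rewrite (N_circle z1) !rmorphM /= ?rmorphXn /= conjCK.
move: (z ^+ n) (z^* ^+ n) zn (c^*) cc (D.[z]^*) (E.[z]^*).
by move=> w zb zn cb cc d e; ring: zn cc.
Qed.

(** With s = E / D and p = N / D, so that s = - 2 eta and p = eta^2 at the node, a
    double zero of s^2 - 4 p amounts to s' = - p' / eta. *)
Lemma deriv_royal_node s eta : D.[s] != 0 -> E.[s] = - 2 * eta * D.[s] ->
  N.[s] = eta ^+ 2 * D.[s] -> (royal_poly D N E)^`().[s] = 0 ->
  eta ^+ 2 * D^`().[s] + N^`().[s] + eta * E^`().[s] = 0.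
Proof.
move=> D0 Es Ns; rewrite /royal_poly derivB derivZ derivM expr2 derivM.
rewrite !hornerE /= Es Ns => e.
have : (4 * D.[s]) * (eta ^+ 2 * D^`().[s] + N^`().[s] + eta * E^`().[s]) = 0.
  by rewrite -[RHS]e; ring.
by move/eqP; rewrite mulf_eq0 mulf_eq0 pnatr_eq0 (negbTE D0) => /eqP.
Qed.

(** Phi_omega o h is unimodular on the circle; here is the reason in terms of
    reflections. *)
Lemma phi_num_refl omega : `|omega| = 1 ->
  phi_num omega N E = (omega * c) *: refl n (phi_den omega D E).
Proof.
move=> o1; have sP : (size (phi_den omega D E) <= n.+1)%N.
  rewrite (leq_trans (size_polyD _ _)) // geq_max size_polyN.
  by rewrite !(leq_trans (size_scale_leq _ _)).
apply: poly_eq_circle => z z1; rewrite hornerZ horner_refl_circle //.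
rewrite horner_phi_num horner_phi_den [in LHS](E_circle z1) (N_circle z1).
have oo := circle_mulC o1; rewrite rmorphB !rmorphM /= conjC_nat.
by move: (omega^*) oo (D.[z]^*) (E.[z]^*) => ob oo d e; ring: oo.
Qed.
End Symmetric.

Lemma phi_num_node omega D N E eta s : E.[s] = - 2 * eta * D.[s] ->
  N.[s] = eta ^+ 2 * D.[s] ->
  (phi_num omega N E).[s] = eta * (phi_den omega D E).[s].
Proof. by move=> Es Ns; rewrite horner_phi_num horner_phi_den Es Ns; ring. Qed.

(** With eta^2 D' + N' + eta E' = 0, the left-hand side is a multiple of
    s (N' - eta^2 D'), which the phasar derivative 2 rho of N / D determines. *)
Lemma phi_phasar omega D N E eta rho s : eta != 0 ->
  E.[s] = - 2 * eta * D.[s] ->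
  eta ^+ 2 * D^`().[s] + N^`().[s] + eta * E^`().[s] = 0 ->
  s * (N^`().[s] - eta ^+ 2 * D^`().[s]) = 2 * rho * eta ^+ 2 * D.[s] ->
  s * ((phi_num omega N E)^`().[s] - eta * (phi_den omega D E)^`().[s]) =
    rho * eta * (phi_den omega D E).[s].
Proof.
move=> eta0 Es dE pN; apply: (mulfI eta0).
rewrite /phi_num /phi_den !derivB !derivZ !hornerE /= Es.
transitivity ((1 + omega * eta) * (s * (N^`().[s] - eta ^+ 2 * D^`().[s])) +
    s * (omega * eta - 1) *
      (eta ^+ 2 * D^`().[s] + N^`().[s] + eta * E^`().[s])); first by ring.
by rewrite pN dE; ring.
Qed.
End RoyalPolynomial.

(** * Extremal properties of Gamma *)

Section GammaGeometry.
Variable C : numClosedFieldType.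
Implicit Types (z w a omega : C).

(** Phi_omega maps Gamma into the closed disc. With u = omega z and v = omega w, the
    difference of the squares of the two sides is
    2 (1 - |u|^2) |1 - v|^2 + 2 (1 - |v|^2) |1 - u|^2. *)
Lemma Phi_contractive omega z w : `|omega| = 1 -> `|z| <= 1 -> `|w| <= 1 ->
  `|2 * omega * (z * w) - (z + w)| <= `|2 - omega * (z + w)|.
Proof.
move=> o1 z1 w1; rewrite -(@ler_pXn2r _ 2) ?nnegrE // -subr_ge0.
have -> : `|2 - omega * (z + w)| ^+ 2 - `|2 * omega * (z * w) - (z + w)| ^+ 2 =
    2 * (1 - `|z| ^+ 2) * `|1 - omega * w| ^+ 2 +
    2 * (1 - `|w| ^+ 2) * `|1 - omega * z| ^+ 2.
  rewrite !normCK !rmorphB !rmorphM !rmorphD /= ?rmorph1 ?conjC_nat ?rmorphM.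
  move: (circle_mulC o1) (z^*) (w^*) => /=.
  by move: (omega^*) => ob oo zb wb; ring: oo.
by rewrite addr_ge0 // !mulr_ge0 ?exprn_ge0 // subr_ge0 expr_le1.
Qed.

(** Points of the circle are extreme points of the disc. *)
Lemma midpoint_circle a z w : `|a| = 1 -> `|z| <= 1 -> `|w| <= 1 ->
  z + w = 2 * a -> z = a.
Proof.
move=> a1 z1 w1 zw; apply/eqP; rewrite -subr_eq0 -normr_le0.
rewrite -(@ler_pXn2r _ 2) ?nnegrE // expr0n /=.
have : `|z| ^+ 2 + `|w| ^+ 2 <= 1 + 1 by rewrite lerD // expr_le1.
have wE : w = 2 * a - z by rewrite -zw addrC addKr.
have -> : `|z| ^+ 2 + `|w| ^+ 2 = (1 + 1) * `|a| ^+ 2 + (1 + 1) * `|z - a| ^+ 2.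
  by rewrite wE !normCK !rmorphB rmorphM /= conjC_nat; ring.
rewrite a1 expr1n mulr1 gerDl pmulr_rle0 //.
Qed.
End GammaGeometry.

(** * Royal interpolation and Blaschke interpolation *)

Section Solutions.
Variable R : realType.
Local Notation C := R[i].
Local Notation tofrac := (@FracField.tofrac {poly C}).
Local Notation normc := (@Normc.normc R).
Implicit Types (z : C) (f phi : ratfun R) (N M D E : {poly C}).

Lemma reval_circle_le f (B : R) z :
  (forall w, disc w -> normc (reval f w) <= B) -> (rden f).[z] != 0 ->
  `|z| = 1 -> normc (reval f z) <= B.
Proof.
move=> fB Mz z1; have [t _ zE] := expi_surj z1.
rewrite zE in Mz *; have := cvg_normc (radial_limit_reval Mz).
move=> h; apply: (cvgr_to_le (h _)) => //.
near=> r; apply: fB; apply/discP; rewrite Normc.normcM normc_real.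
rewrite ((normc1P _).1 (norm_expi t)) mulr1 gtr0_norm; last first.
  by near: r; exact: nbhs_left_gt.
by near: r; exact: nbhs_left_lt.
Unshelve. all: by end_near. Qed.

(** A converse to [inner_refl], in which the bound on the disc is a hypothesis instead of
    a consequence of the maximum principle. *)
Lemma rational_inner_quotient N M f : f = tofrac N / tofrac M ->
  coprimep N M -> (forall z, `|z| <= 1 -> M.[z] != 0) ->
  (forall z, disc z -> `|N.[z]| <= `|M.[z]|) ->
  (forall z, `|z| = 1 -> `|N.[z]| = `|M.[z]|) -> rational_inner f.
Proof.
move=> fE cNM M0 leNM eNM.
have Mn0 : M != 0 by apply: contraTneq (M0 0 _) => [->|]; rewrite ?horner0 ?eqxx // normr0.
have fz := reval_div _ Mn0 cNM fE.
have fN : reval f = (fun z => N.[z] / M.[z]) by apply/funext.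
have bd z : disc z -> `|reval f z| <= 1.
  move=> z1; rewrite fz normf_div ler_pdivrMr ?mul1r ?leNM // normr_gt0 M0 //.
  exact: ltW.
split=> [z z1|z /bd //|]; first by rewrite fN; apply: derivable_divC; rewrite M0 // ltW.
apply: aeW => t; have z1 := norm_expi t.
exists (reval f (expi t)).
  by rewrite /circle /= fz normf_div eNM // divff // normr_eq0 M0 // z1.
apply: radial_limit_reval.
have [a a0 [_ ->]] := rnum_rden_unique Mn0 cNM fE.
by rewrite hornerZ mulf_neq0 // M0 // z1.
Qed.

End Solutions.

Section RoyalSolutions.
Variables (R : realType) (n k : nat) (hk : (k <= n)%N).
Local Notation C := R[i].
Local Notation tofrac := (@FracField.tofrac {poly C}).
Local Notation normc := (@Normc.normc R).
Variables (sigma eta : 'I_n -> C) (rho : 'I_k -> R).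
Hypothesis data : Blaschke_data sigma eta rho.

Lemma node_cdisc j : `|sigma j| <= 1.
Proof.
have [_ b i _] := data; have [jk|kj] := ltnP j k.
  by have [-> _] := b j jk.
by have [/ltW] := i j kj.
Qed.

Lemma boundary_node j : `|sigma j| = 1 -> exists i : 'I_k, j = widen_ord hk i.
Proof.
have [_ b i _] := data; move=> s1; have [jk|kj] := ltnP j k.
  by exists (Ordinal jk); apply: val_inj.
by have [] := i j kj; rewrite /disc /= s1 ltxx.
Qed.

Lemma boundary_nodeE (j : 'I_k) :
  `|sigma (widen_ord hk j)| = 1 /\ `|eta (widen_ord hk j)| = 1.
Proof. by have [_ b _ _] := data; apply: b => /=. Qed.

(** The polynomial data of a solution h of the royal interpolation problem that are
    used to compare it with the solutions of the Blaschke problem. The fields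
    [rf_stat] and [rf_phasar] state 2 s' / s = p' / p and A p = 2 rho at the boundary
    nodes. *)
Record royal_form (h : ratfun R * ratfun R) (c : C) (D N E : {poly C}) : Prop := {
  rf_c : `|c| = 1;
  rf_D0 : forall z, `|z| <= 1 -> D.[z] != 0;
  rf_sD : (size D <= n.+1)%N;
  rf_sE : (size E <= n.+1)%N;
  rf_N : N = c *: refl n D;
  rf_E : E = c *: refl n E;
  rf_h1 : h.1 = tofrac E / tofrac D;
  rf_h2 : h.2 = tofrac N / tofrac D;
  rf_Gamma : forall z, disc z -> Gamma (E.[z] / D.[z], N.[z] / D.[z]);
  rf_royal : royal_poly D N E != 0;
  rf_nodeE : forall j, E.[sigma j] = - 2 * eta j * D.[sigma j];
  rf_nodeN : forall j, N.[sigma j] = eta j ^+ 2 * D.[sigma j];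
  rf_stat : forall j : 'I_k, let s := sigma (widen_ord hk j) in
    let e := eta (widen_ord hk j) in
    e ^+ 2 * D^`().[s] + N^`().[s] + e * E^`().[s] = 0;
  rf_phasar : forall j : 'I_k, let s := sigma (widen_ord hk j) in
    let e := eta (widen_ord hk j) in
    s * (N^`().[s] - e ^+ 2 * D^`().[s]) = 2 * (rho j)%:C%C * e ^+ 2 * D.[s];
  rf_root : forall z, `|z| <= 1 -> (royal_poly D N E).[z] = 0 ->
    exists j, z = sigma j }.

(** The homotopy is followed through its second component only, which takes its
    values in the circle. *)
Lemma topological_degree_rdegree (h : ratfun R * ratfun R) (D : {poly C}) c m :
  (forall z, `|z| <= 1 -> D.[z] != 0) -> `|c| = 1 ->
  (forall z, `|z| = 1 -> reval h.2 z = c * z ^+ m * ((D.[z])^* / D.[z])) ->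
  has_topological_degree (reval2 h) n -> m = n.
Proof.
move=> D0 c1 h2 [H [cH bH H0 H1]].
apply: (@winding_refl_quotient R D c m n (snd \o H) (reval h.2)) => //.
- by move=> x; apply: (@continuous_comp _ _ _ _ snd); [exact: cH|exact: cvg_snd].
- by move=> t z t01 z1; have [] := bGamma_conj (bH t z t01 z1).
- by move=> z z1; rewrite /= H0.
- by move=> z z1; rewrite /= H1.
Qed.

Lemma royal_solution_form (h : ratfun R * ratfun R) :
  royal_Gamma_solution hk sigma eta rho h ->
  ~ (reval2 h @` @disc R `<=` @royal R) ->
  exists c D N E, royal_form h c D N E.
Proof.
move=> [hin htop hnode hph] hroyal.
have [D0 [c [E [c1 NE sE EE [h1 h1z]]]]] := Gamma_inner_refl hin.
set D := rden h.2 in D0 NE h1 h1z *; set N := rnum h.2 in NE *.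
have sD : (size D <= (rdegree h.2).+1)%N by have [_ []] := leq_size_rdegree h.2.
have h2z z : reval h.2 z = N.[z] / D.[z] by [].
(* The winding number of p along the circle is its degree as a rational function. *)
have deg : rdegree h.2 = n.
  apply: (topological_degree_rdegree D0 c1) htop => z z1.
  by rewrite h2z (N_circle sD NE z1) mulrA.
rewrite deg in NE sE EE sD.
have s1 := node_cdisc.
have nE j : E.[sigma j] = - 2 * eta j * D.[sigma j].
  have [e _] := hnode j; move: e; rewrite h1z // => <-.
  by rewrite mulfVK // D0.
have nN j : N.[sigma j] = eta j ^+ 2 * D.[sigma j].
  have [_ e] := hnode j; move: e; rewrite h2z => <-.
  by rewrite mulfVK // D0.
have hG z : disc z -> Gamma (E.[z] / D.[z], N.[z] / D.[z]).
  move=> z1; have [_ _ /(_ z z1) + _] := hin.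
  by rewrite /reval2 h1z // ltW.
(* Otherwise h(z) = (2 w, w^2) with w = s(z) / 2 all over the disc. *)
have r0 : royal_poly D N E != 0.
  apply/eqP => re; apply: hroyal => _ [z z1 <-].
  have z1' : `|z| <= 1 by exact: ltW.
  have Dz := D0 z z1'; exists (E.[z] / D.[z] / 2).
  rewrite /reval2 h1z // h2z; congr pair; first by field.
  have := congr1 (fun p : {poly C} => p.[z]) re; rewrite horner_royal horner0.
  move/eqP; rewrite subr_eq0 => /eqP e.
  have -> : (E.[z] / D.[z] / 2) ^+ 2 = E.[z] ^+ 2 / (4 * D.[z] ^+ 2) by field.
  by rewrite -e; field.
have sb z : disc z -> normc (reval h.1 z) <= 2.
  have [_ _ G _] := hin; move=> /G/Gamma_bounds[/= + _].
  by rewrite normcR -[2](rmorph_nat (real_complex R)) lecR.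
(* Boundary nodes are minima of 4 |D|^2 - |E|^2 on the circle. *)
have dr j : `|sigma j| = 1 -> (royal_poly D N E)^`().[sigma j] = 0.
  move=> sj; have [t _ tE] := expi_surj sj; rewrite tE.
  pose K x : R := 4 * normc D.[expi x] ^+ 2 - normc E.[expi x] ^+ 2.
  apply: (@deriv_eq0_at_min R _ (c%:P * 'X^n) K t) => [x|x|x|].
  - rewrite (royal_circle sD sE NE EE (norm_expi x)) hornerM hornerC hornerXn.
    congr (_ * _); rewrite !normcR /K rmorphB rmorphM !rmorphXn /=.
    by rewrite (rmorph_nat (real_complex R)).
  - rewrite subr_ge0 -[4](_ : 2 ^+ 2 = _ :> R); last by rewrite -natrX.
    rewrite -exprMn ler_pXn2r ?nnegrE ?mulr_ge0 ?normc_ge0 //.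
    have x1 : `|expi x| <= 1 :> C by rewrite norm_expi.
    have := reval_circle_le sb (bounded_no_pole sb x1) (norm_expi x).
    rewrite h1z // Normc.normcM Normc.normcV ler_pdivrMr //.
    by rewrite lt_neqAle normc_ge0 andbT eq_sym; apply: contra_neq (D0 _ x1) => /Normc.eq0_normc.
  - have := derivable_normc2 (cderive_horner D x).
    have := derivable_normc2 (cderive_horner E x) => dE dD.
    exact: (@derivable_scaleB _ 4 _ _ x dD dE).
  - have [i jE] := boundary_node sj; have [_ /normc1P ej] := boundary_nodeE i.
    rewrite /K -tE nE !Normc.normcM jE ej normcN.
    have -> : normc 2 = 2 by rewrite -[2](rmorph_nat (real_complex R)) normc_real normr_nat.
    ring.
have droot z : `|z| <= 1 -> (royal_poly D N E).[z] = 0 -> exists j, z = sigma j.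
  move=> z1 rz.
  have szl : size (codom sigma) = n by rewrite size_codom card_ord.
  have : z \in codom sigma.
    apply: (@reflective_root_mem _ _ (royal_poly D N E) (c^* ^+ 2)) => //.
    - by apply/injectiveP; have [] := data.
    - by rewrite szl (size_royal sD sE NE).
    - by rewrite szl (refl_royal c1 sD sE NE EE).
    move=> _ /codomP[j ->]; split=> //; last exact: dr.
    by rewrite horner_royal nE nN; ring.
  by move=> /codomP.
exists c, D, N, E; split=> //.
- by rewrite [LHS]ratfunE.
- move=> j s e; apply: deriv_royal_node; [exact: D0 (s1 _)|exact: nE|exact: nN|].
  by apply: dr; have [] := boundary_nodeE j.
move=> j s e; have [sj ej] := boundary_nodeE j; rewrite -/s -/e in sj ej.
have D0' z : `|z| = 1 -> D.[z] != 0 by move=> z1; rewrite D0 // z1.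
have ND z : `|z| = 1 -> `|N.[z]| = `|D.[z]|.
  by move=> z1; rewrite (N_circle sD NE z1) !normrM normrX norm_conjC z1 c1 expr1n !mul1r.
have := hph j; rewrite -/s.
move=> /(phasar_polyP (2 * rho j) (fun z _ => h2z z) D0' ND sj).
have Ds : D.[s] != 0 by exact: D0'.
rewrite nN -/e => eq; apply: (mulIf Ds).
have -> : s * (N^`().[s] - e ^+ 2 * D^`().[s]) * D.[s] =
  s * (N^`().[s] * D.[s] - e ^+ 2 * D.[s] * D^`().[s]) by ring.
by rewrite eq rmorphM (rmorph_nat (real_complex R)) /=; ring.
Qed.
End RoyalSolutions.

Lemma Phi_div (K : fieldType) (omega e m d : K) : d != 0 ->
  Phi omega (e / d, m / d) = (2 * omega * m - e) / (2 * d - omega * e).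
Proof.
move=> d0; rewrite /Phi /=.
have -> : 2 * omega * (m / d) - e / d = (2 * omega * m - e) / d by field.
have -> : 2 - omega * (e / d) = (2 * d - omega * e) / d by field.
by rewrite -mulf_div divff ?mulr1 // invr_eq0.
Qed.

Lemma horner_cross (K : comNzRingType) (A B S T : {poly K}) x :
  (A * B - S * T).[x] = A.[x] * B.[x] - S.[x] * T.[x].
Proof. by rewrite !hornerE. Qed.

Lemma horner_deriv_cross (K : comNzRingType) (A B S T : {poly K}) x :
  (A * B - S * T)^`().[x] =
  A^`().[x] * B.[x] + A.[x] * B^`().[x] - (S^`().[x] * T.[x] + S.[x] * T^`().[x]).
Proof. by rewrite derivB !derivM !hornerE. Qed.

Section Correspondence.
Variables (R : realType) (n k : nat) (hk : (k <= n)%N).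
Local Notation C := R[i].
Local Notation tofrac := (@FracField.tofrac {poly C}).
Local Notation normc := (@Normc.normc R).
Variables (sigma eta : 'I_n -> C) (rho : 'I_k -> R).
Hypothesis data : Blaschke_data sigma eta rho.
Variables (h : ratfun R * ratfun R) (c : C) (D N E : {poly C}).
Hypothesis F : royal_form hk sigma eta rho h c D N E.

Let c1 := rf_c F.
Let D0 := rf_D0 F.
Let sD := rf_sD F.
Let sE := rf_sE F.
Let NE := rf_N F.
Let EE := rf_E F.
Let s1 := node_cdisc data.

Lemma size_phi_den omega : (size (phi_den omega D E) <= n.+1)%N.
Proof.
rewrite (leq_trans (size_polyD _ _)) // geq_max size_polyN.
by rewrite !(leq_trans (size_scale_leq _ _)).
Qed.

(** The value s(z) = 2 conj(omega) is extremal in Gamma, where it is only attained with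
    p(z) = conj(omega)^2. On the circle the latter follows from s = conj(s) p. *)
Lemma phi_den_root_royal omega z : `|omega| = 1 -> `|z| <= 1 ->
  (phi_den omega D E).[z] = 0 -> (royal_poly D N E).[z] = 0.
Proof.
move=> o1 z1 /eqP; rewrite horner_phi_den subr_eq0 => /eqP Q0.
have Dz := D0 z1; have ow := circle_mulC o1.
have Ez : E.[z] = 2 * omega^* * D.[z].
  by rewrite [2 * _]mulrC -mulrA Q0 mulrA [omega^* * _]mulrC ow mul1r.
suff Nz : N.[z] = omega^* ^+ 2 * D.[z] by rewrite horner_royal Ez Nz; ring.
have [z1'|z1'] := eqVneq `|z| 1.
  apply: (mulfI (x := 2)); first by rewrite pnatr_eq0.
  have Ez' := E_circle sE EE z1'.
  have := congr1 Num.conj Q0; rewrite !rmorphM /= conjC_nat => Q0'.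
  rewrite (N_circle sD NE z1').
  have -> : 2 * (c * z ^+ n * D.[z]^*) = c * z ^+ n * (2 * D.[z]^*) by ring.
  by rewrite Q0' mulrCA -Ez' Ez; ring.
have /(rf_Gamma F)[a [b [a1 b1 [ab nb]]]] : disc z by rewrite /disc /= lt_neqAle z1' z1.
have oc : `|omega^*| = 1 by rewrite norm_conjC.
have ab2 : a + b = 2 * omega^* by rewrite -ab Ez mulfK.
have ea := midpoint_circle oc a1 b1 ab2.
have eb : b = omega^* by rewrite addrC in ab2; exact: midpoint_circle oc b1 a1 ab2.
by rewrite -(divfK Dz N.[z]) nb ea eb.
Qed.

Lemma phi_den_node omega j : (phi_den omega D E).[sigma j] =
  2 * D.[sigma j] * (1 + omega * eta j).
Proof. by rewrite horner_phi_den (rf_nodeE F); ring. Qed.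

(** Zeros of the denominator are zeros of the royal polynomial, thus nodes, and
    omega eta_j = -1 at the node. *)
Lemma phi_den_neq0_cdisc omega z : `|omega| = 1 ->
  (forall j : 'I_k, omega <> - (eta (widen_ord hk j))^*) ->
  `|z| <= 1 -> (phi_den omega D E).[z] != 0.
Proof.
move=> o1 oeta z1; apply/eqP => Q0.
have [j zj] := rf_root F z1 (phi_den_root_royal o1 z1 Q0).
move: Q0; rewrite zj phi_den_node => /eqP; rewrite !mulf_eq0 pnatr_eq0 /=.
rewrite (negbTE (D0 (s1 j))) /= addrC addr_eq0 => /eqP oe.
have e1 : `|eta j| = 1 by have := congr1 Num.norm oe; rewrite normrM o1 mul1r normrN1.
have [_ b i _] := data; have [jk|kj] := ltnP j k; last first.
  by have [_] := i j kj; rewrite /disc /= e1 ltxx.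
apply: (oeta (Ordinal jk)).
rewrite (_ : widen_ord hk _ = j); last exact: val_inj.
by rewrite -[LHS]mulr1 -(circle_mulC e1) mulrA oe mulN1r.
Qed.

Lemma phi_den_neq0 omega : `|omega| = 1 -> phi_den omega D E != 0.
Proof.
move=> o1; apply/eqP => Q0; have := rf_royal F; apply/negP/negPn/eqP.
apply: poly_eq_circle => z z1; rewrite horner0.
by apply: (phi_den_root_royal o1); rewrite ?z1 // Q0 horner0.
Qed.

Lemma Phi_compE omega : `|omega| = 1 ->
  Phi_comp omega h = tofrac (phi_num omega N E) / tofrac (phi_den omega D E).
Proof.
move=> o1; have Q0 := phi_den_neq0 o1.
have Dn0 : D != 0.
  by apply: contraTneq (D0 (z := 0) _) => [->|]; rewrite ?horner0 ?eqxx // normr0.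
have d0 : tofrac D != 0 by rewrite tofrac_eq0.
have tC (a : C) : tofrac (2 * a)%:P = 2 * tofrac a%:P.
  by rewrite polyCM tofracM (rmorph_nat polyC) (rmorph_nat (@FracField.tofrac {poly C})).
have t2 : tofrac (2 : C)%:P = 2.
  by rewrite (rmorph_nat polyC) (rmorph_nat (@FracField.tofrac {poly C})).
rewrite /Phi_comp [h]surjective_pairing (rf_h1 F) (rf_h2 F) Phi_div // /rconst.
by rewrite /phi_num /phi_den -!mul_polyC !tofracB !tofracM tC t2.
Qed.

Lemma Phi_comp_Blaschke_solution omega : `|omega| = 1 ->
  (forall j : 'I_k, omega <> - (eta (widen_ord hk j))^*) ->
  Blaschke_solution hk sigma eta rho (Phi_comp omega h).
Proof.
move=> o1 oeta; set P := phi_num omega N E; set Q := phi_den omega D E.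
have fE : Phi_comp omega h = tofrac P / tofrac Q := Phi_compE o1.
have Qn0 : Q != 0 := phi_den_neq0 o1.
have Q0 z : `|z| <= 1 -> Q.[z] != 0 := phi_den_neq0_cdisc o1 oeta.
have sQ : (size Q <= n.+1)%N := size_phi_den omega.
have PE : P = (omega * c) *: refl n Q := phi_num_refl sD sE NE EE o1.
have oc1 : `|omega * c| = 1 by rewrite normrM o1 c1 mulr1.
have cPQ : coprimep P Q.
  rewrite coprimep_sym PE coprimepZr ?circle_neq0 //.
  exact: coprimep_refl_self.
have PQ z : `|z| = 1 -> `|P.[z]| = `|Q.[z]|.
  move=> z1; rewrite PE hornerZ horner_refl_circle // !normrM normrX norm_conjC.
  by rewrite z1 o1 c1 expr1n !mul1r.
have fz z : reval (Phi_comp omega h) z = P.[z] / Q.[z] := reval_div z Qn0 cPQ fE.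
have Pnode j : P.[sigma j] = eta j * Q.[sigma j].
  exact: phi_num_node (rf_nodeE F j) (rf_nodeN F j).
split.
- apply: (rational_inner_quotient fE) => // z z1.
  have Dz : D.[z] != 0 by rewrite D0 // ltW.
  have [a [b [a1 b1 [ab nb]]]] := rf_Gamma F z1.
  rewrite -(ler_pM2r (x := `|D.[z]|^-1)) ?invr_gt0 ?normr_gt0 // -!normfV -!normrM.
  have -> : P.[z] / D.[z] = 2 * omega * (a * b) - (a + b).
    by rewrite horner_phi_num -ab -nb; field.
  have -> : Q.[z] / D.[z] = 2 - omega * (a + b).
    by rewrite horner_phi_den -ab; field.
  exact: Phi_contractive.
- rewrite (rdegree_div Qn0 cPQ fE).
  (* The top coefficient of P is a multiple of conj(Q(0)), and Q(0) != 0. *)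
  have sP : size P = n.+1.
    rewrite PE size_scale ?circle_neq0 //; apply/eqP; rewrite eqn_leq size_refl /=.
    rewrite ltnNge; apply/negP => /leq_sizeP/(_ n (leqnn n)).
    rewrite coef_refl // subnn => /eqP; rewrite conjC_eq0 -horner_coef0; apply/negP.
    by apply: Q0; rewrite normr0 ler01.
  by rewrite sP (maxn_idPl sQ).
- by move=> j; rewrite fz Pnode mulfK // Q0.
- move=> j; have [sj ej] := boundary_nodeE hk data j.
  apply/(phasar_polyP (N := P) (M := Q)) => //.
  + by move=> z z1; rewrite Q0 // z1.
  have e0 : eta (widen_ord hk j) != 0 by rewrite circle_neq0.
  have := phi_phasar omega e0 (rf_nodeE F _) (rf_stat F j) (rf_phasar F j).
  rewrite -/P -/Q Pnode => e.
  have -> q : sigma (widen_ord hk j) * (P^`().[sigma (widen_ord hk j)] * q -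
      eta (widen_ord hk j) * q * Q^`().[sigma (widen_ord hk j)]) =
    (sigma (widen_ord hk j) * (P^`().[sigma (widen_ord hk j)] -
      eta (widen_ord hk j) * Q^`().[sigma (widen_ord hk j)])) * q by ring.
  by rewrite e; ring.
Qed.

(** The parameter omega is fixed by the value of phi at one more point tau of the
    circle; the cross difference of phi and Phi_omega o h then has too many zeros. No value of
    omega has to be avoided, because the numerator and the denominator of Phi_omega o h
    satisfy the interpolation conditions as a pair even where both vanish. *)
Lemma Blaschke_solution_Phi_comp phi : Blaschke_solution hk sigma eta rho phi ->
  exists2 omega : C, `|omega| = 1 & phi = Phi_comp omega h.
Proof.
move=> [[_ bphi aephi] deg hnode hph].
have [M0 [u u1 nphi]] := inner_refl bphi aephi.
rewrite deg in nphi; set M := rden phi in M0 nphi; set P' := rnum phi in nphi.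
have [sP' [sM _]] := leq_size_rdegree phi; rewrite deg -/P' -/M in sP' sM.
have PM z : `|z| = 1 -> `|P'.[z]| = `|M.[z]|.
  move=> z1; rewrite nphi hornerZ horner_refl_circle // !normrM normrX norm_conjC.
  by rewrite z1 u1 expr1n !mul1r.
have M0' z : `|z| = 1 -> M.[z] != 0 by move=> z1; rewrite M0 // z1.
have P'node j : P'.[sigma j] = eta j * M.[sigma j].
  by rewrite -hnode mulfVK // M0.
have szl : size (codom sigma) = n by rewrite size_codom card_ord.
(* The extra interpolation point. *)
have [tau t1 tl] := exists_circle_notin (codom sigma).
have t1' : `|tau| <= 1 by rewrite t1.
have Dt := D0 t1'; have Mt := M0 _ t1'.
have [zeta zeta1 P't] : exists2 zeta, `|zeta| = 1 & P'.[tau] = zeta * M.[tau].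
  exists (P'.[tau] / M.[tau]); last by rewrite divfK.
  by rewrite normf_div PM // divff // normr_eq0.
pose v := 2 * zeta * D.[tau] + E.[tau].
(* v = 0 means |s(tau)| = 2, and then tau is a zero of the royal polynomial. *)
have v0 : v != 0.
  apply/eqP => /eqP; rewrite addr_eq0 => /eqP e.
  have E2 : `|E.[tau]| = 2 * `|D.[tau]|.
    by rewrite -normrN -e (normrM _ D.[tau]) (normrM 2) zeta1 mulr1 normr_nat.
  have [] := rf_root F t1' _.
    by rewrite (royal_circle sD sE NE EE t1) E2 exprMn -natrX subrr mulr0.
  by move=> j tj; move: tl; rewrite tj codom_f.
have wE : 2 * N.[tau] + zeta * E.[tau] = c * tau ^+ n * zeta * v^*.
  rewrite /v rmorphD !rmorphM /= conjC_nat (N_circle sD NE t1).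
  rewrite {1}(E_circle sE EE t1); have zz := circle_mulC zeta1.
  by move: (zeta^*) zz (D.[tau]^*) (E.[tau]^*) => zb zz d e; ring: zz.
(* Solves 2 omega p - s = zeta (2 - omega s) at tau; it is unimodular because
   the denominator is a unimodular multiple of conj(v). *)
pose omega := v / (2 * N.[tau] + zeta * E.[tau]).
have w1 : `|2 * N.[tau] + zeta * E.[tau]| = `|v|.
  rewrite wE (normrM _ v^*) (normrM _ zeta) normrM normrX norm_conjC.
  by rewrite c1 t1 zeta1 expr1n !mul1r.
have o1 : `|omega| = 1 by rewrite normf_div w1 divff // normr_eq0.
have oE : omega * (2 * N.[tau] + zeta * E.[tau]) = 2 * zeta * D.[tau] + E.[tau].
  by rewrite /omega divfK // -normr_eq0 w1 normr_eq0.
move: omega o1 oE => omega o1 oE.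
exists omega => //; rewrite Phi_compE // [LHS]ratfunE -/P' -/M.
set P := phi_num omega N E; set Q := phi_den omega D E.
have sQ : (size Q <= n.+1)%N := size_phi_den omega.
have PE : P = (omega * c) *: refl n Q := phi_num_refl sD sE NE EE o1.
have sP : (size P <= n.+1)%N.
  by rewrite PE (leq_trans (size_scale_leq _ _)) // size_refl.
have Qn0 : Q != 0 := phi_den_neq0 o1.
apply/eqP; rewrite eqr_div ?tofrac_eq0 ?rden_neq0 // -!tofracM tofrac_eq.
rewrite -subr_eq0; apply/negPn/negP => G0; move: tl; apply/negP/negPn.
set G := P' * Q - P * M in G0 *.
have Pnode j : P.[sigma j] = eta j * Q.[sigma j].
  exact: phi_num_node (rf_nodeE F j) (rf_nodeN F j).
have szG : (size G <= (2 * n).+1)%N.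
  rewrite (leq_trans (size_polyD _ _)) // geq_max size_polyN.
  by rewrite !size_mul_leq2n.
apply: (@reflective_root_mem _ _ G (- (u * (omega * c))^*)) => //.
- by apply/injectiveP; have [] := data.
- by rewrite szl.
- rewrite szl; apply: poly_eq_circle => z z1; rewrite hornerZ.
  have oc1 : `|omega * c| = 1 by rewrite normrM o1 c1 mulr1.
  move: (omega * c) oc1 PE => oc oc1 PE'.
  have uu := circle_mulC u1; have occ := circle_mulC oc1.
  have ePz : P.[z] = oc * (z ^+ n * Q.[z]^*) by rewrite PE' hornerZ horner_refl_circle.
  have eP'z : P'.[z] = u * (z ^+ n * M.[z]^*) by rewrite nphi hornerZ horner_refl_circle.
  have zn : z ^+ n * (z ^+ n)^* = 1 by rewrite circle_mulC // normrX z1 expr1n.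
  rewrite horner_refl_circle // !horner_cross ePz eP'z mul2n -addnn exprD.
  move: (z ^+ n) (M.[z]) (Q.[z]) zn => w m q ww.
  rewrite !(rmorphB Num.conj, rmorphM Num.conj) /= !conjCK.
  move: (w^*) ww (m^*) (q^*) (u^*) uu (oc^*) occ => wb ww mb qb ub uu ocb occ.
  ring: ww uu occ.
- move=> _ /codomP[j ->]; split => //; first by rewrite horner_cross P'node Pnode; ring.
  move=> sj1; have [i ji] := boundary_node hk data sj1.
  have s0 : sigma j != 0 by rewrite circle_neq0.
  have [_ ej] := boundary_nodeE hk data i.
  have e0 : eta j != 0 by rewrite ji circle_neq0.
  have := hph i; rewrite -ji => /(phasar_polyP (rho i) (fun z _ => erefl) M0' PM sj1).
  rewrite -/P' -/M P'node => ph1.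
  have h1 := rf_stat F i; have h2 := rf_phasar F i; rewrite -ji /= in h1 h2.
  have := phi_phasar omega e0 (rf_nodeE F j) h1 h2; rewrite -/P -/Q => ph2.
  apply: (mulfI s0); rewrite mulr0 horner_deriv_cross P'node Pnode.
  have Ms := M0' _ sj1.
  have ph1' : sigma j * (P'^`().[sigma j] - eta j * M^`().[sigma j]) =
      (rho i)%:C%C * eta j * M.[sigma j].
    apply: (mulIf Ms); rewrite -mulrA -ph1; ring.
  transitivity (Q.[sigma j] * (sigma j * (P'^`().[sigma j] - eta j * M^`().[sigma j]))
    - M.[sigma j] * (sigma j * (P^`().[sigma j] - eta j * Q^`().[sigma j]))).
    by ring.
  by rewrite ph1' ph2; ring.
- rewrite /G horner_cross P't horner_phi_num horner_phi_den.
  transitivity (M.[tau] * (2 * zeta * D.[tau] + E.[tau] -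
    omega * (2 * N.[tau] + zeta * E.[tau]))); first by ring.
  by rewrite oE subrr mulr0.
Qed.
End Correspondence.

Unset Implicit Arguments.

Theorem theorem1p6 (R : realType) (n k : nat) (hn : (1 <= n)%N) (hk : (k <= n)%N)
  (sigma eta : 'I_n -> R[i]) (rho : 'I_k -> R)
  (hdata : Blaschke_data sigma eta rho)
  (h : ratfun R * ratfun R)
  (hsol : royal_Gamma_solution hk sigma eta rho h)
  (hroyal : ~ (reval2 h @` @disc R `<=` @royal R)) :
  (forall omega : R[i], circle omega ->
     (forall j : 'I_k, omega <> - (eta (widen_ord hk j))^*) ->
     Blaschke_solution hk sigma eta rho (Phi_comp omega h)) /\
  (forall phi : ratfun R, Blaschke_solution hk sigma eta rho phi ->
     exists2 omega : R[i], circle omega & phi = Phi_comp omega h).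
Proof.
have [c [D [N [E F]]]] := royal_solution_form hdata hsol hroyal.
split=> [omega o1 oeta|phi].
  exact: (Phi_comp_Blaschke_solution hdata F).
exact: (Blaschke_solution_Phi_comp hdata F).
Qed.
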